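(* Let $r$ and $n$ be coprime integers with $1\le r\le n-1$. Then the GIT quotient $T\backslash\!\backslash (X^{v_{r,n}}_{w_{r,n}})^{ss}_T(\mathcal{L}(n\omega_r))$ is a point.
   Context: $G=SL(n,\mathbb{C})$, $T$ is the subgroup of diagonal matrices, $B$ (resp. $B^-$) the subgroup of upper (resp. lower) triangular matrices, $P=P_{\hat{\alpha_r}}$ the stabilizer of $\langle e_1,\dots,e_r\rangle$, and $G/P=G_{r,n}$ is the Grassmannian of $r$-dimensional subspaces of $\mathbb{C}^n$. Minimal-length coset representatives $w\in W^{S\setminus\{\alpha_r\}}$ of $W=S_n$ modulo $W_P$ are identified with increasing $r$-tuples $(w(1)<\dots<w(r))$ in $\{1,\dots,n\}$. Put $e_w=[e_{w(1)}\wedge\cdots\wedge e_{w(r)}]$; $X(w)$ is the closure of $Be_w$, $X^v$ is the closure of $B^-e_v$, and the Richardson variety is $X^v_w=X(w)\cap X^v$. $\mathcal{L}(\omega_r)$ is the pullback of $\mathcal{O}(1)$ under the Plücker embedding with its natural $T$-linearization, and $\mathcal{L}(n\omega_r)=\mathcal{L}(\omega_r)^{\otimes n}$. For a $T$-stable closed subvariety $X\subseteq G_{r,n}$ and a $T$-linearized ample line bundle $\mathcal L$, $X^{ss}_T(\mathcal{L})$ is the set of points $x\in X$ for which some $T$-invariant section over $X$ of a positive power of $\mathcal L$ does not vanish at $x$; the GIT quotient is $T\backslash\!\backslash X^{ss}_T(\mathcal{L})=\mathrm{Proj}\bigoplus_{m\ge0}H^0(X,\mathcal{L}^{\otimes m})^T$.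 For $1\le i\le r$, let $a_i$ be the smallest integer with $a_i r\ge i n$. Then $w_{r,n}=(a_1,\dots,a_r)$ (so $X(w_{r,n})$ is the unique minimal Schubert variety admitting semistable points for $\mathcal{L}(n\omega_r)$) and $v_{r,n}=(1,a_1,\dots,a_{r-1})$ (so $X^{v_{r,n}}_{w_{r,n}}$ is the smallest Richardson variety in $X(w_{r,n})$ admitting semistable points). *)

(* Defs.v *)
From HB Require Import structures.
From mathcomp Require Import all_boot all_order all_algebra.
From mathcomp Require Import mathcomp_extra boolp classical_sets functions reals.
From mathcomp Require Import complex.
From mathcomp Require Export mpoly.

Set Implicit Arguments.
Unset Strict Implicit.
Unset Printing Implicit Defensive.

Import Order.TTheory GRing.Theory Num.Theory.
Local Open Scope ring_scope.
Local Open Scope classical_set_scope.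

(* Minimal length representatives of S_n / W_P as increasing r-tuples.  The
   set {1, ..., n} is encoded by 'I_n, hence all entries are shifted by one. *)
Definition minrep (r n : nat) :=
  {w : {ffun 'I_r -> 'I_n} | [forall i : 'I_r, forall j : 'I_r, (i < j)%N ==> (w i < w j)%N]}.

Section Grassmannian.
Variables (K : closedFieldType) (r n : nat).

Local Notation nP := #|{: minrep r n}|.

(* The exterior power of degree r of K^n, in the basis of the
   e_I = e_{I(1)} /\ ... /\ e_{I(r)}, with I increasing. *)
Definition extpow := {ffun minrep r n -> K}.

Definition ebasis (w : minrep r n) : extpow := [ffun I => (I == w)%:R].

(* The wedge product of the rows of A. *)
Definition wedge (A : 'M[K]_(r, n)) : extpow :=
  [ffun I : minrep r n => \det (colsub (val I) A)].

(* The linear action of g on the exterior power: the coefficient of e_I in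
   g e_J is the (I, J) minor of g. *)
Definition extact (g : 'M[K]_n) (x : extpow) : extpow :=
  [ffun I : minrep r n =>
     \sum_(J : minrep r n) \det (mxsub (val I) (val J) g) * x J].

Definition evalp (F : {mpoly K[nP]}) (x : extpow) : K :=
  F.@[fun k : 'I_nP => x (enum_val k)].

(* A subset of the projective space of extpow is represented by the set of
   all nonzero vectors x such that [x] belongs to it. *)
Definition grassmannian : set extpow :=
  [set x | x != 0 /\ exists A : 'M[K]_(r, n), x = wedge A].

(* Zariski closure in the Grassmannian of {[x] | x in Y}. *)
Definition zclosure (Y : set extpow) : set extpow :=
  [set x | grassmannian x /\
     forall (d : nat) (F : {mpoly K[nP]}), F \is d.-homog ->
       (forall y, Y y -> evalp F y = 0) -> evalp F x = 0].

Definition SL : set 'M[K]_n := [set g | \det g = 1].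
Definition borel : set 'M[K]_n := [set g | SL g /\ is_trig_mx g^T].
Definition borel_opp : set 'M[K]_n := [set g | SL g /\ is_trig_mx g].
Definition torus : set 'M[K]_n := [set g | SL g /\ is_diag_mx g].

Definition schubert (w : minrep r n) : set extpow :=
  zclosure [set extact b (ebasis w) | b in borel].
Definition schubert_opp (v : minrep r n) : set extpow :=
  zclosure [set extact b (ebasis v) | b in borel_opp].
Definition richardson (v w : minrep r n) : set extpow :=
  schubert w `&` schubert_opp v.

Section Sections.
Variable X : set extpow.

(* Sections over X of the k-th power of L(omega_r): functions on the cone
   over X (minus the origin) which are locally quotients of homogeneous
   polynomials in the Pluecker coordinates whose degrees differ by k. *)
Definition is_section (k : nat) (s : X -> K) :=
  forall x : X, exists (d : nat) (F G : {mpoly K[nP]}),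
    [/\ F \is (d + k).-homog, G \is d.-homog, evalp G (val x) != 0 &
        forall y : X, evalp G (val y) != 0 ->
          s y = evalp F (val y) / evalp G (val y)].

Definition torus_invariant (s : X -> K) :=
  forall (t : 'M[K]_n) (x y : X),
    torus t -> val y = extact t (val x) -> s y = s x.

(* H^0(X, L(q omega_r)^m)^T *)
Definition invariant_sections (q m : nat) : set (X -> K) :=
  [set s | is_section (q * m) s /\ torus_invariant s].

End Sections.
End Grassmannian.

Arguments richardson K {r n} v w.
Arguments invariant_sections {K r n} X q m.

(* Proj of a graded K-algebra of functions: S m is the piece of degree m, and
   the algebra is the internal direct sum of the S m.  For the S m of
   invariant_sections with q > 0 and X stable under nonzero scalars, the sum
   is indeed direct: s (c x) = c ^ (q m) s x for s in S m, and K is infinite. *)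
Section Proj.
Variables (K : fieldType) (T : Type) (S : nat -> set (T -> K)).

Definition graded_alg : set (T -> K) :=
  [set f | exists (N : nat) (g : nat -> T -> K),
     (forall m, S m (g m)) /\ f = \sum_(m < N) g m].

Definition is_ideal (I : set (T -> K)) :=
  [/\ I `<=` graded_alg, I 0,
      forall f g, I f -> I g -> I (f + g) &
      forall f g, graded_alg f -> I g -> I (f * g)].

Definition is_homogeneous (I : set (T -> K)) :=
  forall (N : nat) (g : nat -> T -> K), (forall m, S m (g m)) ->
    I (\sum_(m < N) g m) -> forall m, (m < N)%N -> I (g m).

Definition is_prime (I : set (T -> K)) :=
  ~ I 1 /\ forall f g, graded_alg f -> graded_alg g ->
    I (f * g) -> I f \/ I g.

Definition Proj : set (set (T -> K)) :=
  [set p | [/\ is_ideal p, is_homogeneous p, is_prime p &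
     exists (m : nat) (f : T -> K), [/\ (0 < m)%N, S m f & ~ p f]]].

(* The local ring of Proj at p consists of the fractions f / g with f and g
   in the same S m and g not in p; this is equality of two such fractions. *)
Definition frac_eq (p : set (T -> K)) (f g f' g' : T -> K) :=
  exists (l : nat) (h : T -> K),
    [/\ S l h, ~ p h & h * (f * g' - f' * g) = 0].

(* Proj is isomorphic to Spec K over K: it has exactly one point p, and the
   map c |-> c / 1 from K to the local ring at p is bijective. *)
Definition Proj_is_point :=
  exists2 p, Proj = [set p] &
    forall (m : nat) (f g : T -> K), S m f -> S m g -> ~ p g ->
      exists! c : K, frac_eq p f g (cst c) 1.

End Proj.

(* a r n i is the smallest integer a with i n <= a r. *)
Section MinimalIndex.
Variables (r n : nat) (hrn : (0 < r < n)%N).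

Fact minidx_ex (i : nat) : exists a, (i * n <= a * r)%N.
Proof.
by exists (i * n)%N; case/andP: hrn => r_gt0 _; exact: leq_pmulr.
Qed.

Definition minidx (i : nat) : nat := ex_minn (minidx_ex i).

Fact minidx_le (i : nat) : (i <= r)%N -> (minidx i <= n)%N.
Proof.
rewrite /minidx; case: ex_minnP => a _ amin ir.
by apply: amin; rewrite mulnC leq_mul2l ir orbT.
Qed.

Fact minidx_gt0 (i : nat) : (0 < minidx i.+1)%N.
Proof.
rewrite /minidx; case: ex_minnP => -[|a] // + _.
by rewrite mul0n leqn0 muln_eq0 /=; case/andP: hrn => _; case: n.
Qed.

Fact minidx_lt (i : nat) : (minidx i < minidx i.+1)%N.
Proof.
have /andP[_ rn] := hrn.
have := minidx_gt0 i; rewrite /minidx.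
case: ex_minnP => -[//|b] hb _ _; case: ex_minnP => a _ amin.
rewrite ltnS; apply: amin; rewrite -(leq_add2l n) -mulSn.
by apply: (leq_trans hb); rewrite mulSn leq_add2r ltnW.
Qed.

Definition wval (i : nat) : nat := (minidx i.+1).-1.
Definition vval (i : nat) : nat := (if i is 0 then 1%N else minidx i).-1.

Fact wval_lt (i : 'I_r) : (wval i < n)%N.
Proof. by rewrite /wval prednK ?minidx_gt0// minidx_le. Qed.

Fact vval_lt (i : 'I_r) : (vval i < n)%N.
Proof.
rewrite /vval; case: i => -[|i] /= ir; last first.
  by rewrite prednK ?minidx_gt0// minidx_le// ltnW.
by case/andP: hrn => _; apply: leq_trans.
Qed.

Fact wval_mono (i j : nat) : (i < j)%N -> (wval i < wval j)%N.
Proof.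
move: i j; apply: (homo_ltn (@ltn_trans)) => i.
by rewrite /wval -ltnS !prednK ?minidx_gt0// minidx_lt.
Qed.

Fact minidx1_gt1 : (1 < minidx 1)%N.
Proof.
rewrite /minidx; case: ex_minnP => -[|[|a]] //; case/andP: hrn => _ rn.
  by rewrite mul1n mul0n leqn0 => /eqP n0; rewrite n0 in rn.
by rewrite !mul1n leqNgt rn.
Qed.

Fact vval_mono (i j : nat) : (i < j)%N -> (vval i < vval j)%N.
Proof.
case: j => // j; case: i => [_|i]; last exact: (@wval_mono i j).
have w0 : (0 < wval 0)%N by rewrite /wval -ltnS prednK ?minidx_gt0// minidx1_gt1.
by case: j => // j; apply: leq_trans w0 (ltnW (@wval_mono 0 j.+1 _)).
Qed.

Fact w_rn_incr : [forall i : 'I_r, forall j : 'I_r, (i < j)%N ==>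
  ([ffun i : 'I_r => Ordinal (wval_lt i)] i
     < [ffun i : 'I_r => Ordinal (wval_lt i)] j)%N].
Proof.
by apply/forallP => i; apply/forallP => j; apply/implyP => ij;
  rewrite !ffunE /= wval_mono.
Qed.

Fact v_rn_incr : [forall i : 'I_r, forall j : 'I_r, (i < j)%N ==>
  ([ffun i : 'I_r => Ordinal (vval_lt i)] i
     < [ffun i : 'I_r => Ordinal (vval_lt i)] j)%N].
Proof.
by apply/forallP => i; apply/forallP => j; apply/implyP => ij;
  rewrite !ffunE /= vval_mono.
Qed.

(* (a_1, ..., a_r) and (1, a_1, ..., a_{r-1}), shifted by one. *)
Definition w_rn : minrep r n :=
  Sub [ffun i : 'I_r => Ordinal (wval_lt i)] w_rn_incr.
Definition v_rn : minrep r n :=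
  Sub [ffun i : 'I_r => Ordinal (vval_lt i)] v_rn_incr.

End MinimalIndex.

(* Main.v *)
Require Import Defs.
From mathcomp Require Import all_boot all_order all_algebra all_fingroup.
From mathcomp Require Import boolp classical_sets functions reals complex.
From mathcomp Require Import finset zify ring.

(** The variety X = X^v_w has dimension n - 1, which is the dimension of the
    torus T.  The reason for the theorem is that the semistable points of X
    form one single T-orbit, so that an invariant section is determined by its
    value at one point of this orbit.

    The skew shape between v = v_{r,n} and w = w_{r,n} is a ribbon: row i occupies
    the columns from v i to w i, and v (i + 1) = w i.  The base point x0 of X is the
    row space of the 0/1 matrix with ones exactly on the ribbon.  The bipartite
    graph of rows and columns given by the ribbon is a tree, so every matrix
    whose nonzero entries fill the ribbon comes from x0 by scaling rows and
    columns ([band_torus]).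

    Let s be an invariant section of positive degree and let the row space of A be a
    point of X where s does not vanish.  For a set J of columns, consider the
    one-parameter subgroup of T with one weight on J and another one outside J.  If
    #|f^-1 J| / #|J| > r / n for every basis f of columns of A, then the
    point degenerates under this subgroup with strictly positive weights only,
    and s has to vanish there ([unstable_section0]).  Hence for every J some
    basis satisfies the opposite inequality.  Applied to the initial and final
    intervals of columns, to the singletons and to the complements of
    singletons, together with the inequalities v <= f <= w that hold on X, this
    forces the row space of A to have a basis with support exactly the ribbon
    ([band_form]).  Here coprimality enters: w i is the largest column k with
    k * r < (i + 1) * n, v i is the smallest one with i * n < (k + 1) * r, and
    the intervals that end or start there have slope on the right side of r / n.
    Therefore the point lies on the orbit of x0, and s vanishes as soon as
    s x0 = 0 ([section_ribbon0]).

    Conversely, an invariant section of degree 1 with value 1 at x0 is the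
    product, over s < n, of the Pluecker coordinates of the tuples
    l |-> (l * n + s) %/ r.  These tuples lie in the ribbon, where the Pluecker
    coordinates of x0 are 1 ([det_band_mx]), and every column occurs r times among
    them, so that the weight of the product is trivial ([christoffel_balanced]).

    A graded algebra whose homogeneous elements of positive degree are
    determined by one value, not always zero, has Proj equal to a point
    ([Proj_is_point_ev]).  Elements of degree 0 are compared after
    multiplication by an element of positive degree. *)

Set Implicit Arguments.
Unset Strict Implicit.
Unset Printing Implicit Defensive.

Import GRing.Theory.
Local Open Scope ring_scope.

(** * Minors and bases of columns *)

(** A permutation cannot map S into the complement of T when #|S| + #|T| > r, so
    every term of the Leibniz expansion meets the block of zeros. *)
Lemma det0_zero_block (R : comPzRingType) (r : nat) (M : 'M[R]_r)
    (S T : {set 'I_r}) :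
  (r < #|S| + #|T|)%N -> (forall i j, i \in S -> j \in T -> M i j = 0) ->
  \det M = 0.
Proof.
move=> rST M0; apply: big1 => s _.
suff /existsP[i /andP[iS siT]] : [exists i, (i \in S) && (s i \in T)].
  by rewrite (bigD1 i)//= M0// mul0r mulr0.
apply/contraT => /existsPn noi; move: rST; rewrite ltnNge.
rewrite -(card_imset (mem S) (@perm_inj _ s)).
have dis : [disjoint [set s i | i in S] & T].
  apply/pred0P => j /=; apply/negbTE/negP => /andP[/imsetP[i iS ->] sT].
  by move: (noi i); rewrite iS sT.
by rewrite -cardsUI (disjoint_setI0 dis) cards0 addn0 -[leqRHS]card_ord max_card.
Qed.

Section Minors.
Variables (K : fieldType) (r n : nat).
Implicit Types (A : 'M[K]_(r, n)) (C : 'M[K]_r) (f g : 'I_r -> 'I_n).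

Definition basis A f := \det (colsub f A) != 0.

Lemma basis_mull C A f : \det C != 0 -> basis (C *m A) f = basis A f.
Proof. by move=> C0; rewrite /basis -mulmx_colsub det_mulmx mulf_eq0 (negPf C0). Qed.

Lemma basis_inj A f : basis A f -> injective f.
Proof.
move=> Af i j fij; apply: contraNeq Af => ij.
rewrite -det_tr; apply/eqP/(determinant_alternate ij) => k.
by rewrite !mxE fij.
Qed.

Lemma det_colsub_perm A f (s : 'S_r) :
  \det (colsub (f \o s) A) = (-1) ^+ s * \det (colsub f A).
Proof.
have -> : colsub (f \o s) A = col_perm s (colsub f A).
  by apply/matrixP => i j; rewrite !mxE.
by rewrite col_permE det_mulmx det_perm odd_permV mulrC.
Qed.

Lemma basis_perm A f (s : 'S_r) : basis A (f \o s) = basis A f.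
Proof. by rewrite /basis det_colsub_perm mulf_eq0 signr_eq0. Qed.

Lemma eq_basis A f g : f =1 g -> basis A f = basis A g.
Proof.
by move=> fg; congr (_ != 0); congr determinant; apply/matrixP => i j; rewrite !mxE fg.
Qed.

(** Replacing the i-th basis column by the column k, the minor becomes the
    coordinate A i k by Cramer's rule.  Thus the zeros of a normalised matrix are
    read off from the column sets that are not bases. *)
Lemma basis_exchange A f i k : colsub f A = 1%:M -> A i k != 0 ->
  basis A (fun j => if j == i then k else f j).
Proof.
move=> Af Aik; apply/negP => /det0P[c /eqP + cA]; apply.
have cf j : (c *m A) 0 (f j) = c 0 j.
  by rewrite -[in RHS](mulmx1 c) -Af mulmx_colsub [RHS]mxE.
have cj j : j != i -> c 0 j = 0.
  move=> ji; rewrite -cf.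
  by move/matrixP: cA => /(_ 0 j); rewrite mulmx_colsub [LHS]mxE (negPf ji) [RHS]mxE.
have : (c *m A) 0 k = 0.
  by move/matrixP: cA => /(_ 0 i); rewrite mulmx_colsub [LHS]mxE eqxx [RHS]mxE.
rewrite mxE (bigD1 i)//= big1 ?addr0; last by move=> j ji; rewrite cj ?mul0r.
move/eqP; rewrite mulf_eq0 (negPf Aik) orbF => /eqP ci.
apply/rowP => j; rewrite mxE; have [->//|] := eqVneq j i; exact: cj.
Qed.

Lemma colsub_normalize A f : basis A f -> colsub f (invmx (colsub f A) *m A) = 1%:M.
Proof. by move=> Af; rewrite -mulmx_colsub mulVmx// unitmxE unitfE. Qed.

(** The greedy basis of the column matroid: a basis of maximal total height h has
    at most as many elements below any threshold as any other basis.  For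
    maximal height the normalised matrix is in echelon form by exchange, and
    then a basis g with too many high elements would produce a block of zeros. *)
Lemma greedy_basis A f0 (h : 'I_n -> nat) : basis A f0 ->
  exists2 f, basis A f & forall g, basis A g -> forall m : nat,
    (#|[set j | h (f j) < m]| <= #|[set j | h (g j) < m]|)%N.
Proof.
move=> Af0.
pose F (f : {ffun 'I_r -> 'I_n}) := \sum_j h (f j).
have Pf0 : basis A (finfun f0) by rewrite (eq_basis _ (ffunE _)).
case: (arg_maxnP (P := fun f : {ffun 'I_r -> 'I_n} => basis A f) F Pf0) => f Af fmax.
exists f => // g Ag m.
pose A1 := invmx (colsub f A) *m A.
have d0 : \det (invmx (colsub f A)) != 0 by rewrite det_inv invr_eq0.
have A1f : colsub f A1 = 1%:M := colsub_normalize Af.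
have ech i k : (h (f i) < h k)%N -> A1 i k = 0.
  move=> hik; apply/eqP; apply: contraTT hik => /(basis_exchange A1f).
  rewrite basis_mull // -(eq_basis _ (ffunE _)) => /fmax /=.
  (* The exchange i |-> k would increase the total height. *)
  rewrite /F (bigD1 i)//= [leqRHS](bigD1 i)//= ffunE eqxx.
  rewrite (eq_bigr (fun j => h (f j))); last by move=> j ji; rewrite ffunE (negPf ji).
  by rewrite leq_add2r -leqNgt.
move: Ag; rewrite -(basis_mull A g d0) -/A1 => Ag.
rewrite leqNgt; apply/negP => lt.
case/negP: Ag; apply/eqP/(@det0_zero_block _ _ _ [set j | (h (f j) < m)%N]
  (~: [set j | (h (g j) < m)%N])).
  by rewrite -[ltnLHS]card_ord -(cardsC [set j | (h (g j) < m)%N]) ltn_add2r.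
by move=> i j; rewrite !inE -leqNgt mxE => fi gj; apply: ech; exact: leq_trans fi gj.
Qed.

End Minors.

(** * Ribbon matrices *)

Lemma ltn_mono_inj r n (u : 'I_r -> 'I_n) :
  (forall i j : 'I_r, (i < j)%N -> (u i < u j)%N) -> injective u.
Proof.
move=> um i j uij; apply/val_inj/eqP; rewrite eqn_leq.
by apply/andP; split; rewrite leqNgt; apply/negP => /um; rewrite uij ltnn.
Qed.

Lemma card_ord_lt n m : (m <= n)%N -> #|[set k : 'I_n | (k < m)%N]| = m.
Proof.
move=> mn; rewrite -sum1_card (eq_bigl (fun k : 'I_n => (k < m)%N)); last first.
  by move=> k; rewrite inE.
by rewrite -(big_ord_widen n (fun=> 1%N) mn) sum1_card card_ord.
Qed.

Lemma card_ord_ge n m : (m <= n)%N -> #|[set k : 'I_n | (m <= k)%N]| = (n - m)%N.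
Proof.
move=> mn; have -> : [set k : 'I_n | (m <= k)%N] = ~: [set k : 'I_n | (k < m)%N].
  by apply/setP => k; rewrite !inE -leqNgt.
by rewrite cardsCs setCK card_ord_lt// card_ord.
Qed.

Section Band.
Variables (K : fieldType) (r n : nat) (v w : 'I_r -> 'I_n).
Hypothesis v_mono : forall i j : 'I_r, (i < j)%N -> (v i < v j)%N.
Hypothesis w_mono : forall i j : 'I_r, (i < j)%N -> (w i < w j)%N.
Hypothesis vSw : forall i j : 'I_r, j = i.+1 :> nat -> v j = w i.

Let v_le (i j : 'I_r) : (i <= j)%N -> (v i <= v j)%N.
Proof. by rewrite leq_eqVlt => /orP[/eqP/val_inj->//|/v_mono/ltnW]. Qed.

Let w_le (i j : 'I_r) : (i <= j)%N -> (w i <= w j)%N.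
Proof. by rewrite leq_eqVlt => /orP[/eqP/val_inj->//|/w_mono/ltnW]. Qed.

Lemma w_le_v (i j : 'I_r) : (i < j)%N -> (w i <= v j)%N.
Proof.
move=> ij; have lt := leq_ltn_trans ij (ltn_ord j).
by rewrite -(vSw (j := Ordinal lt))//; apply: v_le.
Qed.

Definition band_mx : 'M[K]_(r, n) := \matrix_(i, k) (v i <= k <= w i)%N%:R.

(** Only the identity contributes to the Leibniz expansion.  If i is the first index
    moved by s, then i < s i, and i < l for the index l with s l = i.  The row l
    starts at w i or later, so that w i <= u i < u (s i) <= w i. *)
Lemma det_band_mx (u : 'I_r -> 'I_n) :
  (forall i j : 'I_r, (i < j)%N -> (u i < u j)%N) ->
  (forall i, v i <= u i <= w i)%N -> \det (colsub u band_mx) = 1.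
Proof.
move=> u_mono u_band; rewrite /determinant (bigD1 (1%g : 'S_r))//=.
rewrite odd_perm1 mul1r big1 ?mul1r => [|i _]; last by rewrite !mxE perm1 u_band.
rewrite big1 ?addr0// => s s1; suff [i Mi] : exists i, ~~ (v i <= u (s i) <= w i)%N.
  by rewrite (bigD1 i)//= !mxE (negPf Mi) mul0r mulr0.
have [i Mi|all_in] := pickP (fun i => ~~ (v i <= u (s i) <= w i)%N); first by exists i.
have {}all_in i : (v i <= u (s i) <= w i)%N by have /negbFE := all_in i.
exfalso; case/eqP: s1; apply/permP => i; rewrite perm1.
elim/ltn_ind: {i}(i : nat) {-2}i (erefl (i : nat)) => m IH i iE.
have fixed (j : 'I_r) : (j < i)%N -> s j = j by rewrite iE => /IH; apply.
apply/eqP/contraT; rewrite neq_ltn => /orP[si|si].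
  by have /perm_inj sii := fixed _ si; rewrite sii ltnn in si.
pose l := (s^-1)%g i; have sl : s l = i by rewrite /l permKV.
have il : (i < l)%N.
  have [//|li|/val_inj li] := ltngtP i l.
    by have := fixed _ li; rewrite sl => li'; rewrite -li' ltnn in li.
  by move: si; rewrite [in s i]li sl ltnn.
have /andP[_ le1] := all_in i; have /andP[ge2 _] := all_in l; rewrite sl in ge2.
have := leq_trans (w_le_v il) ge2.
by have := u_mono _ _ si; lia.
Qed.

Hypothesis v_lt_w : forall i : 'I_r, (v i < w i)%N.

(** Two rows of the ribbon share a column only if they are consecutive, and then
    exactly one.  Hence the row factors a can be chosen one after the other, so that
    U i k / a i depends on the column k only. *)
Lemma band_torus (U : 'M[K]_(r, n)) :
  (forall i k, (U i k != 0) = (v i <= k <= w i)%N) ->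
  exists (a : 'rV[K]_r) (t : 'rV[K]_n), [/\ forall i, a 0 i != 0,
    forall k, t 0 k != 0 &
    forall i k, U i k = a 0 i * t 0 k * (v i <= k <= w i)%N%:R].
Proof.
move=> Ub.
have Uv i : U i (v i) != 0 by rewrite Ub leqnn ltnW.
have Uw i : U i (w i) != 0 by rewrite Ub leqnn ltnW.
(* The ratio of the row factors of j + 1 and j, dictated by the shared column. *)
pose q j := if (insub j : option 'I_r, insub j.+1 : option 'I_r) is (Some i0, Some i1)
  then U i1 (v i1) / U i0 (w i0) else 1.
have q0 j : q j != 0.
  rewrite /q; case: (insub j : option 'I_r) => [i0|]; last by rewrite oner_eq0.
  case: (insub j.+1 : option 'I_r) => [i1|]; last by rewrite oner_eq0.
  by rewrite mulf_neq0// ?invr_eq0.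
pose a (i : nat) := \prod_(j < i) q j.
have a0 i : a i != 0 by apply/prodf_neq0.
pose t (k : 'I_n) := if [pick i | (v i <= k <= w i)%N] is Some i
  then U i k / a i else 1.
have tE (i : 'I_r) (k : 'I_n) : (v i <= k <= w i)%N -> t k = U i k / a i.
  move=> ik; rewrite /t; case: pickP => [j jk|/(_ i)]; last by rewrite ik.
  suff main (i0 i1 : 'I_r) : (i0 < i1)%N -> (v i0 <= k <= w i0)%N ->
      (v i1 <= k <= w i1)%N -> U i0 k / a i0 = U i1 k / a i1.
    have [ij|ji|/val_inj->//] := ltngtP i j; [symmetry|]; exact: main.
  move=> i01 /andP[_ k0] /andP[k1 _].
  have le01 := w_le_v i01.
  have kw : k = w i0 by apply/val_inj/eqP; rewrite eqn_leq k0 (leq_trans le01).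
  have kv : k = v i1.
    by apply/val_inj/eqP; rewrite eqn_leq k1 andbT kw.
  have {le01} i1E : i1 = i0.+1 :> nat.
    apply/eqP; rewrite eqn_leq i01 andbT leqNgt; apply/negP => lt.
    have := v_mono (i := Ordinal (ltn_trans lt (ltn_ord i1))) (j := i1) lt.
    by rewrite (@vSw i0)// -kw kv ltnn.
  rewrite i1E /a big_ord_recr /= /q valK.
  have -> : insub i0.+1 = Some i1 by rewrite -i1E valK.
  rewrite -/(a i0) {1}kw kv; have := a0 i0; move: (a i0) => b b0.
  by rewrite invfM invf_div [b^-1 * _]mulrC mulrA [U i1 _ * _]mulrCA divff// mulr1.
exists (\row_i a i), (\row_k t k); split=> [i|k|i k]; rewrite ?mxE//.
- rewrite /t; case: pickP => [i|]; rewrite ?oner_eq0//.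
  by rewrite -Ub => Uik; rewrite mulf_neq0 ?invr_eq0.
- have [ik|] := boolP (v i <= k <= w i)%N; last first.
    by rewrite -Ub negbK mulr0 => /eqP.
  by rewrite (tE i)// mulr1 mulrC divfK.
Qed.

(** * Semistable matrices in ribbon form *)

Hypothesis v_slope : forall i : 'I_r, (i * n < (v i).+1 * r)%N.
Hypothesis w_slope : forall i : 'I_r, (w i * r < i.+1 * n)%N.
Hypothesis rn : (r < n)%N.

(* [A_w] and [A_v] say that all bases lie between v and w; with functions that need
   not be increasing, this is expressed by counting.  [A_ss] is the numerical
   criterion of semistability, for the one-parameter subgroups with two weights. *)
Variable A : 'M[K]_(r, n).
Hypothesis A_w : forall f, basis A f -> forall i : 'I_r,
  (i < #|[set j | (f j <= w i)%N]|)%N.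
Hypothesis A_v : forall f, basis A f -> forall i : 'I_r,
  (#|[set j | (f j < v i)%N]| <= i)%N.
Hypothesis A_ss : forall J : {set 'I_n},
  exists2 f, basis A f & (#|[set j | f j \in J]| * n <= #|J| * r)%N.

Lemma basis_onto (f u : 'I_r -> 'I_n) : injective u ->
  basis A f -> (forall i, exists j, f j = u i) -> basis A u.
Proof.
move=> u_inj Af /fin_all_exists[s fs].
have s_inj : injective s by move=> i j sij; apply: u_inj; rewrite -!fs sij.
rewrite (@eq_basis _ _ _ A u (f \o perm s_inj)) ?basis_perm// => i /=.
by rewrite permE fs.
Qed.

(** Semistability for J = [0, w i[ bounds the number of elements below w i of the
    greedy basis by i, because w i * r < (i + 1) * n.  By [A_w] this basis has more
    than i elements up to w i, so that it contains w i. *)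
Lemma band_basis_w : basis A w.
Proof.
have [f0 Af0 _] := A_ss set0.
have [f Af fmin] := greedy_basis (fun k : 'I_n => k : nat) Af0.
apply: (basis_onto (ltn_mono_inj w_mono) Af) => i.
case: (pickP (fun j => f j == w i)) => [j /eqP fj|nj]; first by exists j.
exfalso; have [g Ag] := A_ss [set k : 'I_n | (k < w i)%N].
rewrite (card_ord_lt (ltnW (ltn_ord _))) => /leq_ltn_trans/(_ (w_slope i)).
rewrite ltn_mul2r => /andP[_]; rewrite ltnS leqNgt => /negP[].
apply: (leq_trans (A_w Af i)).
have -> : [set j | g j \in [set k : 'I_n | (k < w i)%N]] = [set j | (g j < w i)%N].
  by apply/setP => j; rewrite !inE.
apply: leq_trans (fmin _ Ag (w i)); apply/subset_leq_card/fintype.subsetP => j.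
by rewrite !inE leq_eqVlt => /orP[/eqP/val_inj fj|//]; have := nj j; rewrite fj eqxx.
Qed.

Let gt_v (i : 'I_r) : ((n - (v i).+1) * r < (r - i) * n)%N.
Proof. by have := v_slope i; have := ltn_ord i; have := ltn_ord (v i); nia. Qed.

(** The mirror image of [band_basis_w], with J = ]v i, n[ and the height n - k. *)
Lemma band_basis_v : basis A v.
Proof.
have [f0 Af0 _] := A_ss set0.
have [f Af fmin] := greedy_basis (fun k : 'I_n => (n - k)%N) Af0.
apply: (basis_onto (ltn_mono_inj v_mono) Af) => i.
case: (pickP (fun j => f j == v i)) => [j /eqP fj|nj]; first by exists j.
exfalso; have [g Ag] := A_ss [set k : 'I_n | (v i < k)%N].
rewrite card_ord_ge// => /leq_ltn_trans/(_ (gt_v i)).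
rewrite ltn_mul2r => /andP[_]; rewrite ltnNge => /negP[].
have := fmin _ Ag (n - v i)%N.
have e (h : 'I_r -> 'I_n) : [set j | (n - h j < n - v i)%N] = [set j | (v i < h j)%N].
  by apply/setP => j; rewrite !inE ltn_sub2lE// ltnW.
rewrite !e.
have -> : [set j | g j \in [set k : 'I_n | (v i < k)%N]] = [set j | (v i < g j)%N].
  by apply/setP => j; rewrite !inE.
apply: leq_trans.
have -> : [set j | (v i < f j)%N] = ~: [set j | (f j < v i)%N].
  apply/setP => j; rewrite !inE -leqNgt [RHS]leq_eqVlt.
  have -> : (v i == f j :> nat) = false by rewrite eq_sym; exact: nj j.
  by [].
by rewrite cardsCs setCK card_ord leq_sub2l// A_v.
Qed.

(* The two normal forms of A: the rows of A1 end at the columns w, those of B start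
   at the columns v. *)
Let A1 := invmx (colsub w A) *m A.
Let B := invmx (colsub v A) *m A.
Let A1w : colsub w A1 = 1%:M := colsub_normalize band_basis_w.
Let Bv : colsub v B = 1%:M := colsub_normalize band_basis_v.
Let basis_A1 f : basis A1 f = basis A f.
Proof. by apply: basis_mull; rewrite det_inv invr_eq0; exact: band_basis_w. Qed.
Let basis_B f : basis B f = basis A f.
Proof. by apply: basis_mull; rewrite det_inv invr_eq0; exact: band_basis_v. Qed.

Let A1_ech (i : 'I_r) (k : 'I_n) : (w i < k)%N -> A1 i k = 0.
Proof.
move=> ik; apply/eqP/contraT => /(basis_exchange A1w).
rewrite basis_A1 => /A_w/(_ i); rewrite ltnNge => /negP[].
rewrite -[leqRHS](@card_ord_lt r i (ltnW (ltn_ord i))).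
apply/subset_leq_card/fintype.subsetP => j; rewrite !inE.
case: eqVneq => [_|ji wji]; first by rewrite leqNgt ik.
rewrite ltnNge leq_eqVlt; apply/negP => /orP[/eqP/val_inj ij|/w_mono].
  by rewrite ij eqxx in ji.
by rewrite ltnNge wji.
Qed.

Let B_ech (i : 'I_r) (k : 'I_n) : (k < v i)%N -> B i k = 0.
Proof.
move=> ki; apply/eqP/contraT => /(basis_exchange Bv).
rewrite basis_B => /A_v/(_ i); rewrite leqNgt => /negP[].
rewrite -[leqLHS](card_ord_lt (ltn_ord i)).
apply/subset_leq_card/fintype.subsetP => j; rewrite !inE ltnS.
case: eqVneq => [//|ji]; rewrite leq_eqVlt => /orP[/eqP/val_inj ij|/v_mono//].
by rewrite ij eqxx in ji.
Qed.

(** A nonzero vector of the row space supported in [v i, w i]: the combinations of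
    the first i + 1 rows of A1 vanish after w i, and i linear conditions make
    such a combination vanish at the columns v l with l < i, hence, by comparison
    with B, at all columns before v i. *)
Let band_row (i : 'I_r) : exists c : 'rV[K]_r, [/\ c != 0,
  forall l : 'I_r, (i < l)%N -> c 0 l = 0 &
  forall k : 'I_n, ~~ (v i <= k <= w i)%N -> (c *m A1) 0 k = 0].
Proof.
(* The entries of the product of c and D have to vanish; the column i is free. *)
pose D : 'M[K]_r := \matrix_(p, l)
  (if (l < i)%N then A1 p (v l) else ((p == l) && (l != i))%:R).
have /eqP/det0P[c c0 cD] : \det D = 0.
  apply: (@det0_zero_block _ _ _ setT [set i]).
    by rewrite cardsT card_ord cards1 addn1.
  by move=> p l _ /set1P ->; rewrite mxE ltnn eqxx andbF.
have cDl l : \sum_p c 0 p * D p l = 0.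
  by have /matrixP/(_ 0 l) := cD; rewrite [LHS]mxE [RHS]mxE.
have cgt (l : 'I_r) : (i < l)%N -> c 0 l = 0.
  move=> il; rewrite -[RHS](cDl l) (bigD1 l)//= mxE ltnNge (ltnW il)/= eqxx.
  rewrite (_ : l != i) ?mulr1 ?big1 ?addr0//; last first.
    by rewrite -val_eqE gtn_eqF.
  by move=> p pl; rewrite mxE ltnNge (ltnW il)/= (negPf pl) mulr0.
have clt (l : 'I_r) : (l < i)%N -> (c *m A1) 0 (v l) = 0.
  by move=> li; rewrite -[RHS](cDl l) mxE; apply: eq_bigr => p _; rewrite [D _ _]mxE li.
exists c; split=> // k; rewrite negb_and -!ltnNge => /orP[ki|ki]; last first.
  rewrite mxE big1// => p _; have [pi|pi] := leqP p i; last by rewrite cgt ?mul0r.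
  by rewrite A1_ech ?mulr0//; apply: leq_ltn_trans ki; apply: w_le.
have -> : c *m A1 = colsub v (c *m A1) *m B.
  rewrite -mulmx_colsub -mulmxA -!mulmx_colsub; congr (_ *m _).
  rewrite /B !mulmxA -[X in _ = X *m _]mulmxA mulmxV ?mulmx1//.
  by rewrite unitmxE unitfE; exact: band_basis_v.
rewrite mxE big1// => l _; have [il|li] := leqP i l.
  by rewrite B_ech ?mulr0//; apply: leq_trans ki _; apply: v_le.
by rewrite [colsub _ _ _ _]mxE clt ?mul0r.
Qed.

(** The rows of [band_row] have no zero inside the ribbon, by semistability: a zero
    at w i would put the basis vector of the column v i into the row space (J is
    the singleton of v i); a zero at v i would make the rows from i on start
    after v i (J = ]v i, n[); a zero at an inner column k would be the only entry of
    this column (J is the complement of k).  The entries at the columns w i show at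
    the same time that the rows are independent. *)
Lemma band_form : exists2 C : 'M[K]_r, \det C != 0 &
  forall i k, ((C *m A) i k != 0) = (v i <= k <= w i)%N.
Proof.
have [c cP] := fin_all_exists band_row.
pose C : 'M[K]_r := \matrix_i c i.
have UE i k : (C *m A1) i k = (c i *m A1) 0 k.
  by rewrite !mxE; apply: eq_bigr => p _; rewrite mxE.
have U0 i (k : 'I_n) : ~~ (v i <= k <= w i)%N -> (C *m A1) i k = 0.
  by rewrite UE; case: (cP i) => _ _; apply.
have cii i : c i 0 i = (C *m A1) i (w i).
  by rewrite UE -[in LHS](mulmx1 (c i)) -A1w mulmx_colsub [LHS]mxE.
have Uw i : (C *m A1) i (w i) != 0.
  apply/eqP => Uiw; have [c0 cgt _] := cP i.
  have cA0 k : k != v i -> (c i *m A1) 0 k = 0.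
    rewrite neq_ltn => /orP[kv|vk].
      by rewrite -UE U0// negb_and -ltnNge kv.
    rewrite mxE big1// => p _; have [pi|ip] := ltnP p i.
      by rewrite A1_ech ?mulr0//; apply: leq_ltn_trans vk; apply: w_le_v.
    move: ip; rewrite leq_eqVlt => /orP[/eqP/val_inj <-|/cgt->]; last by rewrite mul0r.
    by rewrite cii Uiw mul0r.
  have [f Af] := A_ss [set v i]; rewrite cards1 mul1n => fv.
  have {fv} f_v j : f j != v i.
    apply/eqP => fj; move: fv; rewrite leqNgt => /negP[]; apply: leq_trans rn _.
    by rewrite leq_pmull// card_gt0; apply/set0Pn; exists j; rewrite !inE fj.
  move: Af; rewrite -basis_A1 => /det0P[]; exists (c i) => //.
  by rewrite mulmx_colsub; apply/rowP => j; rewrite [LHS]mxE cA0// mxE.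
have C0 : \det C != 0.
  rewrite det_trig; last first.
    by apply/is_trig_mxP => i j ij; rewrite mxE; case: (cP i) => _ + _; apply.
  by apply/prodf_neq0 => i _; rewrite mxE cii.
have basisU f : basis (C *m A1) f = basis A f by rewrite basis_mull.
have Uv i : (C *m A1) i (v i) != 0.
  apply/eqP => Uiv; have [f] := A_ss [set k : 'I_n | (v i < k)%N].
  rewrite -basisU => Uf.
  rewrite card_ord_ge// => /leq_ltn_trans/(_ (gt_v i)).
  rewrite ltn_mul2r => /andP[_] lt; move/eqP: Uf; apply.
  apply: (@det0_zero_block _ _ _ [set j : 'I_r | (i <= j)%N]
    (~: [set j | f j \in [set k : 'I_n | (v i < k)%N]])).
    rewrite (card_ord_ge (ltnW (ltn_ord i))) [X in (_ + X)%N]cardsCs setCK card_ord.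
    have arith q : (q < r - i -> r < r - i + (r - q))%N by have := ltn_ord i; lia.
    exact: arith lt.
  move=> j l; rewrite !inE -leqNgt mxE => ij fl.
  move: ij; rewrite leq_eqVlt => /orP[/eqP/val_inj <-|/v_mono vij]; last first.
    by rewrite U0// negb_and -ltnNge (leq_ltn_trans fl).
  move: fl; rewrite leq_eqVlt => /orP[/eqP/val_inj -> //|fl].
  by rewrite U0// negb_and -ltnNge fl.
exists (C *m invmx (colsub w A)).
  rewrite det_mulmx mulf_neq0// det_inv invr_eq0; exact: band_basis_w.
move=> i k; rewrite -mulmxA -/A1; have [|/U0->] := boolP (v i <= k <= w i)%N; last first.
  by rewrite eqxx.
case/andP; rewrite leq_eqVlt => /orP[/eqP/val_inj <- _|vk]; first exact: Uv.
rewrite leq_eqVlt => /orP[/eqP/val_inj ->|kw]; first exact: Uw.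
apply/eqP => Uik; have [f] := A_ss (~: [set k]).
rewrite -basisU => Uf; rewrite [X in (_ <= X * _)%N]cardsCs setCK card_ord cards1.
have [j fj|nj] := pickP (fun j => f j == k).
  move=> _; move/eqP: Uf; apply.
  apply: (@det0_zero_block _ _ _ setT [set j]).
    by rewrite cardsT card_ord cards1 addn1.
  move=> p l _ /set1P->; rewrite mxE (eqP fj).
  have [pi|ip|/val_inj->//] := ltngtP p i.
    by rewrite U0// negb_and -!ltnNge orbC (leq_ltn_trans (w_le_v pi)).
  by rewrite U0// negb_and -!ltnNge (leq_trans kw)// w_le_v.
have -> : [set j | f j \in ~: [set k]] = setT.
  by apply/setP => j; rewrite !inE nj.
by rewrite cardsT card_ord; have := ltn_ord i; nia.
Qed.

End Band.

(** * Grassmannian and Richardson varieties *)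

Section Minrep.
Variables (r n : nat).
Implicit Types (I J : minrep r n).

Lemma minrep_lt I (i j : 'I_r) : (i < j)%N -> (val I i < val I j)%N.
Proof. by move=> ij; have /forallP/(_ i)/forallP/(_ j)/implyP := valP I; apply. Qed.

Lemma minrep_sort (f : 'I_r -> 'I_n) : injective f ->
  exists (I : minrep r n) (s : 'S_r), f =1 val I \o s.
Proof.
move=> f_inj.
pose e : rel 'I_r := fun i j => (f i <= f j)%N.
pose q := sort e (enum 'I_r).
have szq : size q = r by rewrite size_sort size_enum_ord.
have uq : uniq q by rewrite sort_uniq enum_uniq.
pose p (i : 'I_r) := nth i q i.
have pE i j : p i = nth j q i by apply: set_nth_default; rewrite szq.
have p_inj : injective p.
  move=> i j /eqP; rewrite (pE i i) (pE j i) nth_uniq ?szq// => /eqP; exact: val_inj.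
have Iincr : [forall i : 'I_r, forall j : 'I_r, (i < j)%N ==>
    ([ffun i : 'I_r => f (p i)] i < [ffun i : 'I_r => f (p i)] j)%N].
  apply/forallP => i; apply/forallP => j; apply/implyP => ij; rewrite !ffunE.
  rewrite ltn_neqAle; apply/andP; split.
    by apply: contraL ij => /eqP/val_inj/f_inj/p_inj ->; rewrite ltnn.
  have etr : transitive e by move=> a b c; apply: leq_trans.
  have erf : reflexive e by move=> a; rewrite /e.
  have qs : sorted e q by apply: sort_sorted => a b; apply: leq_total.
  have := @sorted_leq_nth _ e etr erf i q qs i j; rewrite !inE szq.
  by move=> /(_ (ltn_ord i) (ltn_ord j) (ltnW ij)); rewrite /e -(pE j i).
exists (Sub [ffun i : 'I_r => f (p i)] Iincr), (perm p_inj)^-1%g => i /=.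
by rewrite ffunE -[X in p X]/(_ i) -(permE p_inj) permKV.
Qed.

(** An increasing tuple is determined by its set of values. *)
Lemma minrep_neq I J : I != J -> exists i, forall j, val J j != val I i.
Proof.
move=> IJ; have [i /forallP Ii|ni] := pickP (fun i => [forall j, val J j != val I i]).
  by exists i.
exfalso; case/eqP: IJ; apply/val_inj/ffunP => i.
pose q (L : minrep r n) := [seq nat_of_ord (val L j) | j <- enum 'I_r].
have qs L : sorted ltn (q L).
  rewrite /q (@sorted_map _ _ (fun j => nat_of_ord (val L j))).
  apply: (@sub_sorted _ (relpre val ltn)) => [j k jk|]; first exact: minrep_lt jk.
  by have := iota_ltn_sorted 0 r; rewrite -val_enum_ord sorted_map.
have sz L : size (q L) = r by rewrite size_map size_enum_ord.
have sub : {subset q I <= q J}.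
  move=> _ /mapP[j _ ->]; have /negbT := ni j; rewrite negb_forall => /existsP[k].
  by rewrite negbK => /eqP <-; apply/mapP; exists k; rewrite ?mem_enum.
have uI : uniq (q I) by apply: sorted_uniq (qs I); [exact: ltn_trans|exact: ltnn].
have qIJ : q I = q J.
  apply: (irr_sorted_eq ltn_trans ltnn) => //.
  by apply: (uniq_min_size uI sub _).2; rewrite !sz.
by apply: val_inj; have /eq_in_map/(_ i (mem_enum 'I_r i)) := qIJ.
Qed.

Lemma minrep_inj I : injective (val I).
Proof. exact: ltn_mono_inj (@minrep_lt I). Qed.

End Minrep.

Section Grass.
Variables (K : closedFieldType) (r n : nat).
Local Notation nP := #|{: minrep r n}|.
Implicit Types (A : 'M[K]_(r, n)) (x y : extpow K r n) (t : 'rV[K]_n).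
Implicit Types (I J : minrep r n) (m : minrep r n -> K).

Lemma wedge_mull (C : 'M[K]_r) A I : wedge (C *m A) I = \det C * wedge A I.
Proof. by rewrite !ffunE -mulmx_colsub det_mulmx. Qed.

Lemma wedge_basis A f : basis A f -> exists I, wedge A I != 0.
Proof.
move=> Af; have [I [s fI]] := minrep_sort (basis_inj Af).
by exists I; rewrite ffunE; move: Af; rewrite (eq_basis _ fI) basis_perm.
Qed.

(** The form taken in Pluecker coordinates both by homotheties (m constant) and by
    diagonal matrices (m = [weight t]). *)
Definition act m x : extpow K r n := [ffun I => m I * x I].
Definition weight t I := \prod_i t 0 (val I i).

Lemma mxsub_diag p (f : 'I_r -> 'I_n) (g : 'I_r -> 'I_p) t (M : 'M[K]_(n, p)) :
  \det (mxsub f g (diag_mx t *m M)) = \prod_i t 0 (f i) * \det (mxsub f g M).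
Proof.
have -> : mxsub f g (diag_mx t *m M) = diag_mx (\row_i t 0 (f i)) *m mxsub f g M.
  by apply/matrixP => i j; rewrite mul_diag_mx [LHS]mxE mul_diag_mx !mxE.
by rewrite det_mulmx det_diag; congr (_ * _); apply: eq_bigr => i _; rewrite mxE.
Qed.

Lemma extact_diag t x : extact (diag_mx t) x = act (weight t) x.
Proof.
apply/ffunP => I; rewrite !ffunE (bigD1 I)//= big1 => [|J JI].
  rewrite addr0 -[diag_mx t]mulmx1 mxsub_diag.
  have -> : mxsub (val I) (val I) (1%:M : 'M[K]_n) = 1%:M.
    apply/matrixP => i j; rewrite !mxE; congr (_%:R); congr nat_of_bool.
    have [->|ij] := eqVneq i j; first by rewrite eqxx.
    apply/negbTE; rewrite neq_ltn.
    have [/minrep_lt -> //|/minrep_lt ->|/val_inj ijE] :=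
      ltngtP i j.
      by rewrite orbT.
    by rewrite ijE eqxx in ij.
  by rewrite det1 mulr1.
have [i Ii] : exists i, forall j, val J j != val I i by apply: minrep_neq; rewrite eq_sym.
rewrite (@det0_zero_block _ _ _ [set i] setT) ?mul0r//.
  by rewrite cardsT card_ord cards1.
by move=> _ j /set1P -> _; rewrite !mxE eq_sym (negPf (Ii j)) mulr0n.
Qed.

Lemma wedge_diag A t : wedge (A *m diag_mx t) = act (weight t) (wedge A).
Proof.
apply/ffunP => I; rewrite !ffunE -det_tr -[in RHS]det_tr.
have -> : (colsub (val I) (A *m diag_mx t))^T = mxsub (val I) id (diag_mx t *m A^T).
  by rewrite mul_mx_diag mul_diag_mx; apply/matrixP => i j; rewrite !mxE mulrC.
by rewrite mxsub_diag; congr (_ * \det _); apply/matrixP => i j; rewrite !mxE.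
Qed.

Lemma evalp_scale d (F : {mpoly K[nP]}) c x : F \is d.-homog ->
  evalp F (act (fun=> c) x) = c ^+ d * evalp F x.
Proof.
move=> /dhomogP Fd; rewrite /evalp !mevalE mulr_sumr.
rewrite [LHS]big_seq_cond [RHS]big_seq_cond; apply: eq_bigr => mon; rewrite andbT => monF.
rewrite mulrCA; congr (_ * _).
under eq_bigr do rewrite ffunE exprMn.
by rewrite big_split/= prodrXr -mdegE (Fd _ monF).
Qed.

Lemma evalpM (F G : {mpoly K[nP]}) x : evalp (F * G) x = evalp F x * evalp G x.
Proof. exact: mevalM. Qed.

Lemma evalpD (F G : {mpoly K[nP]}) x : evalp (F + G) x = evalp F x + evalp G x.
Proof. exact: mevalD. Qed.

Definition pluecker I : {mpoly K[nP]} := 'X_(enum_rank I).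

Lemma evalp_pluecker I x : evalp (pluecker I) x = x I.
Proof. by rewrite /evalp mevalXU enum_rankK. Qed.

Lemma pluecker_homog I : pluecker I \is 1.-homog.
Proof. by rewrite dhomogX /= mdeg1. Qed.

Lemma evalp_act d (F : {mpoly K[nP]}) m : F \is d.-homog ->
  exists2 F' : {mpoly K[nP]}, F' \is d.-homog &
    forall x, evalp F' x = evalp F (act m x).
Proof.
move=> /dhomogP Fd.
exists (\sum_(u <- msupp F) (F@_u * \prod_i m (enum_val i) ^+ u i) *: 'X_[u]).
  rewrite big_seq; apply: rpred_sum => u uF; apply: dhomogZ.
  by rewrite dhomogX; apply/eqP/Fd.
move=> x; rewrite /evalp raddf_sum /= mevalE; apply: eq_bigr => u _.
rewrite mevalZ mevalX -mulrA -big_split /=; congr (_ * _).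
by apply: eq_bigr => i _; rewrite ffunE exprMn.
Qed.

Lemma zclosure_coord (Y : set (extpow K r n)) I x :
  (forall y, Y y -> y I = 0) -> zclosure Y x -> x I = 0.
Proof.
move=> Y0 [_ /(_ _ _ (pluecker_homog I))]; rewrite evalp_pluecker; apply => y Yy.
by rewrite evalp_pluecker Y0.
Qed.

(** Composing a form with the rescaling of coordinates gives a form of the same
    degree, so that rescalings extend to closures. *)
Lemma zclosure_act (Y : set (extpow K r n)) m x :
  (forall y, Y y -> Y (act m y)) -> grassmannian (act m x) ->
  zclosure Y x -> zclosure Y (act m x).
Proof.
move=> Ym Gx [_ Yx]; split=> // d F Fd F0.
have [F' F'd F'E] := evalp_act m Fd.
by rewrite -F'E; apply: Yx F'd _ => y /Ym/F0; rewrite F'E.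
Qed.

Lemma zclosure_scale (Y : set (extpow K r n)) c x :
  grassmannian (act (fun=> c) x) -> zclosure Y x -> zclosure Y (act (fun=> c) x).
Proof.
move=> Gx [_ Yx]; split=> // d F Fd F0.
by rewrite (evalp_scale _ _ Fd) (Yx _ _ Fd F0) mulr0.
Qed.

Lemma torusP (g : 'M[K]_n) : torus g <->
  exists2 t : 'rV[K]_n, \prod_k t 0 k = 1 & g = diag_mx t.
Proof.
split=> [[dg /is_diag_mxP gd]|[t t1 ->]]; last first.
  by split; [rewrite /SL /= det_diag|apply: diag_mx_is_diag].
have gE : g = diag_mx (\row_k g k k).
  apply/matrixP => i j; rewrite !mxE; have [->|ij] := eqVneq i j; first by rewrite mulr1n.
  by rewrite mulr0n gd.
exists (\row_k g k k) => //; rewrite -det_diag -gE; exact: dg.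
Qed.

Lemma extact_ebasis (b : 'M[K]_n) I w :
  extact b (ebasis K w) I = \det (mxsub (val I) (val w) b).
Proof.
rewrite ffunE (bigD1 w)//= big1 ?addr0 => [|J Jw]; rewrite ffunE ?eqxx ?mulr1//.
by rewrite (negPf Jw) mulr0.
Qed.

Lemma act_extact t b w :
  act (weight t) (extact b (ebasis K w)) = extact (diag_mx t *m b) (ebasis K w).
Proof. by apply/ffunP => I; rewrite ffunE !extact_ebasis mxsub_diag. Qed.

Lemma borel_act t w y : \prod_k t 0 k = 1 ->
  [set extact b (ebasis K w) | b in @borel K n]%classic y ->
  [set extact b (ebasis K w) | b in @borel K n]%classic (act (weight t) y).
Proof.
move=> t1 [b [b1 bt] <-]; exists (diag_mx t *m b); last by rewrite act_extact.
split; first by rewrite /SL /= det_mulmx det_diag t1 mul1r; exact: b1.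
apply/is_trig_mxP => i j ij; rewrite mul_diag_mx !mxE.
by have /is_trig_mxP/(_ i j ij) := bt; rewrite mxE => ->; rewrite mulr0.
Qed.

Lemma borel_opp_act t w y : \prod_k t 0 k = 1 ->
  [set extact b (ebasis K w) | b in @borel_opp K n]%classic y ->
  [set extact b (ebasis K w) | b in @borel_opp K n]%classic (act (weight t) y).
Proof.
move=> t1 [b [b1 bt] <-]; exists (diag_mx t *m b); last by rewrite act_extact.
split; first by rewrite /SL /= det_mulmx det_diag t1 mul1r; exact: b1.
apply/is_trig_mxP => i j ij; rewrite mul_diag_mx !mxE.
by have /is_trig_mxP/(_ i j ij) := bt => ->; rewrite mulr0.
Qed.

Lemma grassmannianP A f : basis A f -> grassmannian (wedge A).
Proof.
move=> /wedge_basis[I AI]; split; last by exists A.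
by apply: contraNneq AI => ->; rewrite ffunE.
Qed.

Lemma grassmannian_basis A : grassmannian (wedge A) ->
  exists I : minrep r n, basis A (val I).
Proof.
case=> /eqP A0 _.
have [I AI|A1] := pickP (fun I => wedge A I != 0).
  by exists I; move: AI; rewrite ffunE.
by exfalso; apply: A0; apply/ffunP => I; have /negbFE/eqP -> := A1 I; rewrite ffunE.
Qed.

Lemma wedge_move (C : 'M[K]_r) A t :
  wedge (C *m A *m diag_mx t) = act (fun=> \det C) (act (weight t) (wedge A)).
Proof.
by apply/ffunP => I; rewrite wedge_diag [LHS]ffunE wedge_mull !ffunE mulrCA.
Qed.

Lemma basis_diag A t f : (forall k, t 0 k != 0) -> basis (A *m diag_mx t) f = basis A f.
Proof.
move=> t0; rewrite /basis.
have -> : colsub f (A *m diag_mx t) = colsub f A *m diag_mx (\row_i t 0 (f i)).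
  by rewrite !mul_mx_diag; apply/matrixP => i j; rewrite !mxE.
rewrite det_mulmx det_diag mulf_eq0 negb_or andbC; apply/andb_idl => _.
by apply/prodf_neq0 => i _; rewrite mxE.
Qed.

(** Every Richardson variety is stable under T and, as a cone, under nonzero
    scalars; in terms of matrices, under row operations and column scalings from T. *)
Lemma richardson_move (v w : minrep r n) (C : 'M[K]_r) A t :
  \det C != 0 -> \prod_k t 0 k = 1 -> richardson K v w (wedge A) ->
  richardson K v w (wedge (C *m A *m diag_mx t)).
Proof.
move=> C0 t1 [Xw Xv].
have t0 k : t 0 k != 0.
  by apply/eqP => tk; move/eqP: t1; rewrite (bigD1 k)//= tk mul0r eq_sym oner_eq0.
have [I AI] := grassmannian_basis (proj1 Xw).
have G1 : grassmannian (wedge (A *m diag_mx t)).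
  by apply: (@grassmannianP _ (val I)); rewrite basis_diag.
have G2 : grassmannian (wedge (C *m A *m diag_mx t)).
  by apply: (@grassmannianP _ (val I)); rewrite basis_diag// basis_mull.
rewrite wedge_move; rewrite wedge_diag in G1; rewrite wedge_move in G2.
split; apply: zclosure_scale => //; apply: zclosure_act => // y.
  exact: borel_act.
exact: borel_opp_act.
Qed.

(** The coordinates of B e_w that are not below w vanish because of the block of
    zeros of an upper triangular matrix, and vanishing of a coordinate passes to
    the closure. *)
Lemma richardson_le (v w : minrep r n) A f : richardson K v w (wedge A) -> basis A f ->
  forall i : 'I_r, (i < #|[set j | (f j <= val w i)%N]|)%N.
Proof.
move=> [Xw _] Af i; have [I [s fI]] := minrep_sort (basis_inj Af).
move: Af; rewrite (eq_basis _ fI) basis_perm => AI.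
have -> : [set j | (f j <= val w i)%N] = s @^-1: [set j | (val I j <= val w i)%N].
  by apply/setP => j; rewrite !inE fI.
rewrite card_preimset; last exact: perm_inj.
rewrite ltnNge; apply: contra AI => le; apply/eqP.
have := @zclosure_coord _ I (wedge A) _ Xw; rewrite ffunE; apply => _ [b [_ bt] <-].
rewrite extact_ebasis.
apply: (@det0_zero_block _ _ _ (~: [set j | (val I j <= val w i)%N])
   [set j : 'I_r | (j < i.+1)%N]).
  rewrite (card_ord_lt (ltn_ord i)) cardsCs setCK card_ord.
  have arith q : (q <= i -> r < r - q + i.+1)%N by have := ltn_ord i; lia.
  exact: arith le.
move=> j k; rewrite !inE -ltnNge ltnS mxE => wj ki.
have /is_trig_mxP/(_ (val w k) (val I j)) := bt; rewrite mxE; apply.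
apply: leq_ltn_trans wj; move: ki; rewrite leq_eqVlt => /orP[/eqP/val_inj->//|].
by move=> ki; exact/ltnW/minrep_lt.
Qed.

(** The mirror image of [richardson_le], for lower triangular matrices. *)
Lemma richardson_ge (v w : minrep r n) A f : richardson K v w (wedge A) -> basis A f ->
  forall i : 'I_r, (#|[set j | (f j < val v i)%N]| <= i)%N.
Proof.
move=> [_ Xv] Af i; have [I [s fI]] := minrep_sort (basis_inj Af).
move: Af; rewrite (eq_basis _ fI) basis_perm => AI.
have -> : [set j | (f j < val v i)%N] = s @^-1: [set j | (val I j < val v i)%N].
  by apply/setP => j; rewrite !inE fI.
rewrite card_preimset; last exact: perm_inj.
rewrite leqNgt; apply: contra AI => gt; apply/eqP.
have := @zclosure_coord _ I (wedge A) _ Xv; rewrite ffunE; apply => _ [b [_ bt] <-].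
rewrite extact_ebasis; apply: (@det0_zero_block _ _ _ [set j | (val I j < val v i)%N]
   [set j : 'I_r | (i <= j)%N]).
  rewrite (card_ord_ge (ltnW (ltn_ord i))).
  have arith q : (i < q -> r < q + (r - i))%N by have := ltn_ord i; lia.
  exact: arith gt.
move=> j k; rewrite !inE mxE => vj ik.
have /is_trig_mxP/(_ (val I j) (val v k)) := bt; apply.
apply: (leq_trans vj); move: ik; rewrite leq_eqVlt => /orP[/eqP/val_inj->//|ik].
exact/ltnW/minrep_lt.
Qed.

End Grass.

(** * Unstable points *)

Lemma prod_if_const (R : comPzRingType) (T : finType) (S : {set T}) (a b : R) :
  \prod_i (if i \in S then a else b) = a ^+ #|S| * b ^+ #|~: S|.
Proof.
rewrite (bigID (mem S))/=; congr (_ * _); rewrite -prodr_const.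
  by apply: eq_bigr => i ->.
by apply: eq_big => i; rewrite ?inE// => /negPf ->.
Qed.

Section Curves.
Variables (K : closedFieldType).

(** Algebraically closed fields are infinite; so two polynomials that agree away
    from finitely many points are equal. *)
Lemma poly_eq_off (g p q : {poly K}) : g != 0 ->
  (forall x, x != 0 -> g.[x] != 0 -> p.[x] = q.[x]) -> p = q.
Proof.
move=> g0 pq; apply/eqP; rewrite -subr_eq0; apply/negPn/negP => d0.
have : (p - q) * g * 'X != 0 by rewrite !mulf_neq0 ?polyX_eq0.
move=> /closed_nonrootP[x]; rewrite rootE !hornerE mulf_eq0 negb_or => /andP[h x0].
move: h; rewrite mulf_eq0 negb_or => /andP[dx gx].
by case/negP: dx; rewrite subr_eq0; apply/eqP/pq.
Qed.

(** Forms are polynomial along a polynomial curve of matrices.  This replaces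
    continuity when passing to the limit point of the curve. *)
Lemma evalp_curve r n (F : {mpoly K[#|{: minrep r n}|]}) (M : 'M[{poly K}]_(r, n)) :
  exists P : {poly K}, forall z, P.[z] = evalp F (wedge (map_mx (horner_eval z) M)).
Proof.
pose h (k : 'I_#|{: minrep r n}|) := \det (colsub (val (enum_val k)) M).
exists (mmap polyC h F) => z.
rewrite /evalp mevalE horner_sum; apply: eq_bigr => u _.
rewrite hornerM hornerC horner_prod; congr (_ * _); apply: eq_bigr => k _.
rewrite horner_exp; congr (_ ^+ _); rewrite /h ffunE -/(horner_eval z _) -det_map_mx.
by congr (\det _); apply/matrixP => i j; rewrite !mxE.
Qed.

End Curves.

Section Instability.
Variables (K : closedFieldType) (r n : nat) (v w : minrep r n).
Let X := richardson K v w.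
Implicit Types (A : 'M[K]_(r, n)) (x y : X).

(** In Pluecker coordinates the row operation C is the homothety by its determinant,
    which scales a local quotient of forms by the difference of their degrees. *)
Lemma section_move q m (s : X -> K) x y (C : 'M[K]_r) A (t : 'rV[K]_n) :
  invariant_sections X q m s ->
  \det C != 0 -> \prod_k t 0 k = 1 -> val x = wedge A ->
  val y = wedge (C *m A *m diag_mx t) -> s y = \det C ^+ (q * m) * s x.
Proof.
move=> [sec inv] C0 t1 xA yA.
have Xz : X (act (weight t) (val x)).
  rewrite xA -wedge_diag -[A]mul1mx; apply: richardson_move; rewrite ?det1 ?oner_eq0//.
  by rewrite -xA; apply: set_mem; apply: valP.
pose z : X := exist (fun u => u \in X) _ (mem_set Xz).
have <- : s z = s x.
  by apply: (inv (diag_mx t)); [apply/torusP; exists t|rewrite extact_diag].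
have yz : val y = act (fun=> \det C) (val z) by rewrite yA wedge_move -xA.
have [d [F [G [Fd Gd Gz FG]]]] := sec z.
have Gy : evalp G (val y) != 0 by rewrite yz (evalp_scale _ _ Gd) mulf_neq0// expf_neq0.
rewrite (FG y Gy) (FG z Gz) yz (evalp_scale _ _ Gd) (evalp_scale _ _ Fd) exprD.
by rewrite -[_ * _ * evalp F _]mulrA -mulf_div divff ?mul1r ?mulrA// expf_neq0.
Qed.

(** The easy half of the numerical criterion.  Choose a basis f with #|f^-1 J|
    minimal and normalise A at f.  By minimality the rows i with f i in J are
    supported in J.  Multiplying by z the columns in J of the other rows gives a
    curve M z of matrices; for z = t ^ n it is the action of a one-parameter
    subgroup of T, up to row factors, and the point M 0 is still in the closed
    variety X.  Along the curve s is invariant up to t ^ - (N * q * m), where N > 0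
    measures the instability, while it stays regular at M 0; so it is zero. *)
Lemma unstable_section0 q m (s : X -> K) x A (J : {set 'I_n}) :
  invariant_sections X q m s -> (0 < q * m)%N -> val x = wedge A ->
  (forall f, basis A f -> (#|J| * r < #|[set j | f j \in J]| * n)%N) -> s x = 0.
Proof.
move=> inv_s e0 xA unst; set e := (q * m)%N in e0.
have XA : X (wedge A) by rewrite -xA; apply: set_mem; apply: valP.
have [I AI] := grassmannian_basis (proj1 (proj1 XA)).
pose cnt (f : {ffun 'I_r -> 'I_n}) := #|[set j | f j \in J]|.
have PI : basis A (val I) by [].
case: (arg_minnP (P := fun f : {ffun 'I_r -> 'I_n} => basis A f) cnt PI) => f Af fmin.
pose S := [set j | f j \in J].
pose D0 := invmx (colsub f A).
have D00 : \det D0 != 0 by rewrite det_inv invr_eq0.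
pose A1 := D0 *m A.
have A1f : colsub f A1 = 1%:M := colsub_normalize Af.
have A10 i k : i \in S -> k \notin J -> A1 i k = 0.
  rewrite inE => fi kJ; apply/eqP/contraT => /(basis_exchange A1f).
  rewrite basis_mull // -(eq_basis _ (ffunE _)) => /fmin /=.
  rewrite /cnt leqNgt => /negP[]; rewrite [ltnRHS](cardsD1 i) inE fi ltnS.
  apply/subset_leq_card/fintype.subsetP => j; rewrite !inE ffunE.
  by case: eqVneq => [_ kj|//]; rewrite kj in kJ.
(* All the M z are normalised at f, so none of them degenerates. *)
pose M (z : K) : 'M[K]_(r, n) :=
  \matrix_(i, k) (if (i \notin S) && (k \in J) then z * A1 i k else A1 i k).
have Mf z : basis (M z) f.
  have -> // : basis (M z) f = basis A1 f; last by rewrite basis_mull.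
  congr (\det _ != 0); rewrite A1f; apply/matrixP => i j.
  rewrite [LHS]mxE [LHS]mxE [RHS]mxE.
  have -> : A1 i (f j) = (i == j)%:R.
    by have /matrixP/(_ i j) := A1f; rewrite [LHS]mxE [RHS]mxE.
  case: ifP => // /andP[iS fj]; have -> : (i == j) = false; last by rewrite mulr0.
  by apply: contraNF iS => /eqP ->; rewrite inE.
pose MP : 'M[{poly K}]_(r, n) :=
  \matrix_(i, k) (if (i \notin S) && (k \in J) then 'X * (A1 i k)%:P else (A1 i k)%:P).
have MPE z : map_mx (horner_eval z) MP = M z.
  apply/matrixP => i k; rewrite !mxE /horner_eval.
  by case: ifP => _; rewrite ?hornerM ?hornerX hornerC.
pose a := (n - #|J|)%N; pose b := #|J|.
have JC : #|~: J| = a by rewrite cardsCs setCK card_ord.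
have SC : #|~: S| = (r - #|S|)%N by rewrite cardsCs setCK card_ord.
have nE : n = (a + b)%N by rewrite subnK// -[leqRHS](card_ord n) max_card.
(* Dt is in SL because a * b = b * a; Rt brings the rows back to their scale. *)
pose Rt (t : K) : 'rV[K]_r := \row_i (if i \in S then t^-1 ^+ a else t ^+ b).
pose Dt (t : K) : 'rV[K]_n := \row_k (if k \in J then t ^+ a else t^-1 ^+ b).
have Dt1 t : t != 0 -> \prod_k (Dt t) 0 k = 1.
  move=> t0; under eq_bigr do rewrite mxE.
  rewrite prod_if_const JC -!exprM -/b mulnC -exprMn divff// expr1n //.
have MtE t : t != 0 -> M (t ^+ n) = (diag_mx (Rt t) *m D0) *m A *m diag_mx (Dt t).
  move=> t0; rewrite -(mulmxA _ D0) -/A1 mul_mx_diag; apply/matrixP => i k.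
  rewrite [RHS]mxE mul_diag_mx [in RHS]mxE [Rt t 0 i]mxE [Dt t 0 k]mxE [LHS]mxE.
  case: ifP => [/andP[/negPf -> ->]|].
    by rewrite {1}nE exprD [RHS]mulrAC; congr (_ * _); rewrite mulrC.
  have [iS|iS] := boolP (i \in S); have [kJ|kJ] //= := boolP (k \in J); move=> _.
  - by rewrite mulrAC -exprMn mulVf// expr1n mul1r.
  - by rewrite A10// mulr0 mul0r.
  - by rewrite mulrAC -exprMn divff// expr1n mul1r.
have detR t : \det (diag_mx (Rt t)) = t^-1 ^+ (a * #|S|) * t ^+ (b * (r - #|S|)).
  rewrite det_diag; under eq_bigr do rewrite mxE.
  by rewrite prod_if_const SC -!exprM.
have detR0 t : t != 0 -> \det (diag_mx (Rt t) *m D0) != 0.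
  by move=> t0; rewrite det_mulmx detR !mulf_neq0// expf_neq0// invr_eq0.
have XMt t : t != 0 -> X (wedge (M (t ^+ n))).
  move=> t0; rewrite MtE//; apply: richardson_move; [exact: detR0|exact: Dt1|exact: XA].
have n0 : (0 < n)%N.
  by have /(leq_ltn_trans (leq0n _)) := unst _ Af; rewrite muln_gt0 => /andP[].
have XM0 : X (wedge (M 0)).
  have G0 : grassmannian (wedge (M 0)) by apply: grassmannianP (Mf 0).
  have lim (Y : set (extpow K r n)) :
      (forall t, t != 0 -> zclosure Y (wedge (M (t ^+ n)))) -> zclosure Y (wedge (M 0)).
    move=> Yt; split=> // d F Fd F0; have [P PE] := evalp_curve F MP.
    have P0 : P \Po 'X^n = 0.
      apply: (@poly_eq_off _ 1); rewrite ?oner_eq0// => t t0 _.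
      rewrite horner_comp hornerXn PE MPE horner0.
      by have [_] := Yt t t0; apply; eassumption.
    rewrite -MPE -PE; have := congr1 (horner^~ 0) P0.
    by rewrite horner_comp hornerXn expr0n gtn_eqF// horner0.
  by split; apply: lim => t t0; have [] := XMt t t0.
pose y : X := exist (fun u => u \in X) _ (mem_set XM0).
have [sec _] := inv_s.
have [d [F [G [Fd Gd Gy FG]]]] := sec y.
have [PF PFE] := evalp_curve F MP; have [PG PGE] := evalp_curve G MP.
have PG0 : PG.[0] != 0 by rewrite PGE MPE.
have [N [N0 NE]] : exists N, (0 < N)%N /\ (a * #|S| = N + b * (r - #|S|))%N.
  have := unst _ Af; rewrite -/S -/b {1}nE => lt.
  have Sr : (#|S| <= r)%N by rewrite -[leqRHS](card_ord r) max_card.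
  exists (a * #|S| - b * (r - #|S|))%N; split; nia.
(* Both sides compute the section on the curve through its representation F / G
   near M 0; the denominators t have been cleared. *)
pose kappa := \det D0 ^+ e * s x.
have Pid : 'X^(N * e) * (PF \Po 'X^n) = kappa%:P * (PG \Po 'X^n).
  apply: (@poly_eq_off _ (PG \Po 'X^n)).
    apply: contraNneq PG0 => PG00; have := congr1 (horner^~ 0) PG00.
    by rewrite horner_comp hornerXn expr0n gtn_eqF// horner0 => ->.
  move=> t t0; rewrite !(hornerM, hornerC, horner_comp, hornerXn) => PGt.
  pose z : X := exist (fun u => u \in X) _ (mem_set (XMt t t0)).
  have Gz : evalp G (val z) != 0 by rewrite /= -MPE -PGE.
  have := FG z Gz.
  have zE : val z = wedge _ := congr1 (fun B => wedge B) (MtE t t0).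
  rewrite (section_move inv_s (detR0 t t0) (Dt1 t t0) xA zE) /= -MPE -PFE -PGE.
  move=> /(congr1 (fun u => u * PG.[t ^+ n])); rewrite divfK// => <-.
  rewrite det_mulmx detR NE exprD -/e !exprMn -!exprM.
  rewrite /kappa; have tN := expf_neq0 (N * e) t0.
  have tb := expf_neq0 (b * (r - #|S|) * e) t0.
  rewrite !exprVn; field; by rewrite ?tN ?tb.
have := congr1 (horner^~ 0) Pid; rewrite !(hornerM, hornerC, horner_comp, hornerXn).
have Ne : (0 < N * e)%N by rewrite muln_gt0 N0.
rewrite !expr0n (gtn_eqF Ne) (gtn_eqF n0) mul0r.
move/esym/eqP; rewrite mulf_eq0 (negPf PG0) orbF mulf_eq0 expf_eq0 (negPf D00) andbF.
by move/eqP.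
Qed.

End Instability.

(** * A criterion for Proj to be a point *)

Lemma exists_root (K : closedFieldType) n (z : K) : (0 < n)%N -> exists c, c ^+ n = z.
Proof.
move=> n0; have /closed_rootP[c] : size ('X^n - z%:P) != 1.
  by rewrite size_XnsubC// eqSS -lt0n.
by rewrite rootE !hornerE subr_eq0 => /eqP <-; exists c.
Qed.

(** The graded algebra S consists of functions whose homogeneous components of
    degree m scale by c ^ (n * m) along the ray of a base point x0, and those of
    positive degree are determined by their value at x0. *)
Section ProjPoint.
Variables (K : closedFieldType) (T : Type) (S : nat -> set (T -> K)) (n : nat) (x0 : T).
Hypothesis n0 : (0 < n)%N.
Hypothesis S0 : forall m, S m 0.
Hypothesis SD : forall m f g, S m f -> S m g -> S m (f + g).
Hypothesis SM : forall m l f g, S m f -> S l g -> S (m + l)%N (f * g).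
Hypothesis SC : forall c : K, S 0 (cst c).

(** The multiple of x0 by c, as far as S can see. *)
Definition on_ray (c : K) y := forall m f, S m f -> f y = c ^+ (n * m) * f x0.

Hypothesis scal : forall c : K, c != 0 -> exists y, on_ray c y.
Hypothesis S_ev : forall m f, (0 < m)%N -> S m f -> f x0 = 0 -> f = 0.
Variable m0 : nat.
Variable f0 : T -> K.
Hypothesis m00 : (0 < m0)%N.
Hypothesis Sf0 : S m0 f0.
Hypothesis f0x0 : f0 x0 != 0.

Let SZ m c f : S m f -> S m (cst c * f).
Proof. by move=> Sf; apply: (SM (SC c) Sf). Qed.

Let SX m f k : S m f -> S (k * m)%N (f ^+ k).
Proof.
move=> Sf; elim: k => [|k IH]; first by rewrite expr0 mul0n; apply: (SC 1).
by rewrite exprS mulSn; apply: SM.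
Qed.

Let galg m f : S m f -> graded_alg S f.
Proof.
move=> Sf; exists m.+1, (fun k => if k == m then f else 0); split.
  by move=> k; case: eqP => [->|].
by rewrite big_ord_recr /= eqxx big1 ?add0r// => i _; rewrite ltn_eqF.
Qed.

Let gsum (I : Type) (s : seq I) (F : I -> nat) (g : I -> T -> K) :
  (forall i, S (F i) (g i)) -> graded_alg S (\sum_(i <- s) g i).
Proof.
move=> Sg; elim: s => [|i s IH].
  by rewrite big_nil; apply: (galg (S0 0)).
rewrite big_cons; case: IH => N [h [Sh ->]].
exists (maxn N (F i).+1).
exists (fun k => (if (k < N)%N then h k else 0) + (if k == F i then g i else 0)).
split.
  move=> k; apply: SD; first by case: ifP.
  by case: eqP => [->|].
rewrite big_split /= addrC; congr (_ + _); last first.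
  rewrite (big_ord_widen _ h (leq_maxl N (F i).+1)) big_mkcond /=.
  by apply: eq_bigr.
have ltF : (F i < maxn N (F i).+1)%N by rewrite leq_max leqnn orbT.
rewrite (bigD1 (Ordinal ltF)) //= eqxx big1 ?addr0// => k kF.
by rewrite (negPf (kF : (k != F i :> nat))).
Qed.

Let galgD f g : graded_alg S f -> graded_alg S g -> graded_alg S (f + g).
Proof.
move=> [N [h [Sh ->]]] [M [k [Sk ->]]].
have := @gsum _ (map inl (index_enum 'I_N) ++ map inr (index_enum 'I_M))
  (fun i : 'I_N + 'I_M => match i with inl a => a | inr a => a end : nat)
  (fun i => match i with inl a => h a | inr a => k a end).
rewrite big_cat !big_map /=; apply => -[a|a]; [exact: Sh|exact: Sk].
Qed.

Let galgM f g : graded_alg S f -> graded_alg S g -> graded_alg S (f * g).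
Proof.
move=> [N [h [Sh ->]]] [M [k [Sk ->]]].
rewrite mulr_suml; under eq_bigr do rewrite mulr_sumr.
rewrite pair_big /=.
by apply: (@gsum _ _ (fun ij : 'I_N * 'I_M => (ij.1 + ij.2)%N)) => ij; apply: SM.
Qed.

Let ray_ev N g c y : (forall m, S m (g m)) -> on_ray c y ->
  (\sum_(m < N) g m) y = (\poly_(m < N) g m x0).[c ^+ n].
Proof.
move=> Sg cy; rewrite horner_poly.
have -> : (\sum_(m < N) g m) y = \sum_(m < N) g m y by elim/big_rec2: _ => // i a b _ <-.
by apply: eq_bigr => m _; rewrite (cy _ _ (Sg m)) mulrC exprM.
Qed.

Let ray0 (P : {poly K}) : (forall c y, c != 0 -> on_ray c y -> P.[c ^+ n] = 0) -> P = 0.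
Proof.
move=> P0; apply: (@poly_eq_off _ 1); rewrite ?oner_eq0// => z z0 _.
have [c cz] := exists_root z n0.
have c0 : c != 0 by apply: contraNneq z0 => c0; rewrite -cz c0 expr0n gtn_eqF.
by have [y cy] := scal c0; rewrite horner0 -cz (P0 c y).
Qed.

(* The functions that vanish on the ray of x0.  Vanishing on the whole ray, instead of
   at x0 only, makes the ideal homogeneous. *)
Let p : set (T -> K) :=
  fun f => graded_alg S f /\ forall c y, c != 0 -> on_ray c y -> f y = 0.

Let p_comp N g : (forall m, S m (g m)) -> p (\sum_(m < N) g m) ->
  forall m, (m < N)%N -> g m x0 = 0.
Proof.
move=> Sg [_ gp] m mN.
have /polyP/(_ m) : \poly_(m < N) g m x0 = 0.
  by apply: ray0 => c y c0 cy; rewrite -(ray_ev N Sg cy) (gp c).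
by rewrite coef_poly mN coef0.
Qed.

Let pS m f : S m f -> f x0 = 0 -> p f.
Proof.
by move=> Sf fx; split; [exact: galg Sf|move=> c y _ cy; rewrite (cy _ _ Sf) fx mulr0].
Qed.

Let pS_ev m f : S m f -> p f -> f x0 = 0.
Proof.
move=> Sf [_ pf]; have [y y1] := scal (oner_neq0 K).
by rewrite -(pf 1 y) ?oner_eq0// (y1 _ _ Sf) expr1n mul1r.
Qed.

Let p_ideal : is_ideal S p.
Proof.
split; first by move=> f [].
- exact: (pS (S0 0)).
- move=> f g [Gf f0_] [Gg g0]; split; first exact: galgD.
  by move=> c y c0 cy; rewrite fctE (f0_ c)// (g0 c)// addr0.
- move=> f g Gf [Gg g0]; split; first exact: galgM.
  by move=> c y c0 cy; rewrite fctE (g0 c)// mulr0.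
Qed.

Let p_prime : is_prime S p.
Proof.
split.
  by move=> /(@pS_ev 0 1 (SC 1))/eqP; rewrite [_ x0]/(1 : K) oner_eq0.
move=> _ _ [N [g [Sg ->]]] [M [h [Sh ->]]] [_ gh].
have /eqP : (\poly_(m < N) g m x0) * (\poly_(m < M) h m x0) = 0.
  apply: ray0 => c y c0 cy.
  by rewrite hornerM -(ray_ev N Sg cy) -(ray_ev M Sh cy) -(gh c y).
rewrite mulf_eq0 => /orP[/eqP P0|/eqP P0]; [left|right].
  split; first by exists N, g.
  by move=> c y _ cy; rewrite (ray_ev N Sg cy) P0 horner0.
split; first by exists M, h.
by move=> c y _ cy; rewrite (ray_ev M Sh cy) P0 horner0.
Qed.

Let prime_exp q f k : is_prime S q -> graded_alg S f -> q (f ^+ k) -> q f.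
Proof.
move=> [q1 qM] Gf; elim: k => [|k IH]; first by rewrite expr0.
rewrite exprS => /qM[]//.
by elim: k {IH} => [|k IH]; [exact: (galg (SC 1))|rewrite exprS; exact: galgM].
Qed.

(* A homogeneous g not vanishing at x0 has a power proportional to a power of f,
   up to one factor f, which makes the common degree positive also for g of degree 0. *)
Let p_unique q : Proj S q -> q = p.
Proof.
move=> [qI qH qP [m [f [m_gt0 Sf qf]]]].
have [q_sub q0 qD qM] := qI.
have fx : f x0 != 0 by apply/eqP => fx; apply: qf; rewrite (S_ev m_gt0 Sf fx).
apply/seteqP; split=> h.
  move=> qh; have [N [g [Sg hE]]] := q_sub _ qh.
  suff gx (i : 'I_N) : g i x0 = 0.
    rewrite hE; apply: (big_ind p) => [|u1 u2|i _]; first exact: (pS (S0 0)).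
      by case: p_ideal => _ _ + _; apply.
    exact: pS (Sg i) (gx i).
  have qg : q (g i) by apply: (qH N g Sg) => //; rewrite -hE.
  apply/eqP/negPn/negP => gx; apply: qf; apply: (@prime_exp _ _ i.+1 qP (galg Sf)).
  pose c := g i x0 ^+ m * f x0 / f x0 ^+ i.+1.
  have SL : S (i.+1 * m)%N (f ^+ i.+1) by apply: SX.
  have SR : S (i.+1 * m)%N (g i ^+ m * f).
    by rewrite mulSn addnC mulnC; apply: SM => //; apply: SX.
  have c0 : c != 0 by rewrite !mulf_neq0// ?invr_eq0 ?expf_neq0.
  have -> : f ^+ i.+1 = cst c^-1 * (g i ^+ m * f).
    apply/eqP; rewrite -subr_eq0 -mulN1r; apply/eqP.
    apply: (@S_ev (i.+1 * m)%N); first by rewrite muln_gt0.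
      apply: SD SL _; rewrite (_ : -1 = cst (-1))//; apply: SZ; exact: SZ.
    rewrite !fctE /c (_ : (1 : T -> K) x0 = 1)//; field; by rewrite ?expf_neq0 ?fx ?gx.
  apply: (qM); first exact: galg (SC _).
  have [k mE] : exists k, m = k.+1 by case: m m_gt0 {Sf c SL SR c0} => // k; exists k.
  rewrite mE exprSr -mulrA [g i * f]mulrC mulrA; apply: (qM _ _ _ qg).
  by apply: galgM (galg Sf); apply: galg (SX k (Sg i)).
move=> ph; have [N [g [Sg hE]]] := proj1 ph.
rewrite hE; apply: (big_ind q) => // i _.
have gx : g i x0 = 0 by apply: (p_comp Sg _ (ltn_ord i)); rewrite -hE.
case: qP => _ /(_ (g i) f (galg (Sg i)) (galg Sf)) []//.
rewrite (_ : g i * f = 0)//; apply: (@S_ev (i + m)%N).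
- by rewrite addn_gt0 m_gt0 orbT.
- exact: SM.
- by rewrite fctE gx mul0r.
Qed.

Lemma Proj_is_point_ev : Proj_is_point S.
Proof.
exists p.
  apply/seteqP; split=> q; first by move=> /p_unique ->.
  move=> ->; split=> //; last first.
    by exists m0, f0; split=> // /(pS_ev Sf0)/eqP; rewrite (negPf f0x0).
  by move=> N g Sg pg m mN; apply: pS (Sg m) (p_comp Sg pg mN).
move=> m f g Sf Sg pg.
have gx : g x0 != 0 by apply/eqP => gx; apply: pg; exact: pS Sg gx.
exists (f x0 / g x0); split.
  exists m0, f0; split=> //; first by move=> /(pS_ev Sf0)/eqP; rewrite (negPf f0x0).
  apply: (@S_ev (m0 + m)%N); first by rewrite addn_gt0 m00.
    apply: SM => //; rewrite mulr1 -mulN1r mulrA (_ : -1 * _ = cst (- (f x0 / g x0))).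
      by apply: SD Sf _; exact: SZ.
    by apply/funext => y; rewrite fctE mulN1r.
  by rewrite !fctE mulr1 divfK// subrr mulr0.
move=> c [l [h [Sh ph]]] /(congr1 (fun u => u x0)); rewrite !fctE mulr1.
have hx : h x0 != 0 by apply/eqP => hx; apply: ph; exact: pS Sh hx.
move=> /eqP; rewrite mulf_eq0 (negPf hx) subr_eq0 => /eqP ->.
by rewrite mulfK.
Qed.

End ProjPoint.

(** * The ribbon of slope r / n *)

Section Slopes.
Variables (r n : nat) (hrn : (0 < r < n)%N).
Let r0 : (0 < r)%N. Proof. by case/andP: hrn. Qed.
Let rn : (r < n)%N. Proof. by case/andP: hrn. Qed.

Lemma minidxS i : minidx hrn i.+1 = ((i.+1 * n).-1 %/ r).+1.
Proof.
have n0 : (0 < n)%N by apply: leq_trans rn.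
rewrite /minidx; case: ex_minnP => a ha amin;
apply/eqP; rewrite eqn_leq; apply/andP; split.
  by apply: amin; have := ltn_ceil (i.+1 * n).-1 r0; rewrite prednK// muln_gt0.
by rewrite ltn_divLR//; move: ha; rewrite mulSn; lia.
Qed.

Lemma w_rnE (i : 'I_r) : val (w_rn hrn) i = ((i.+1 * n).-1 %/ r)%N :> nat.
Proof. by rewrite SubK ffunE /= /wval minidxS. Qed.

Let divDr a : ((a + r) %/ r)%N = (a %/ r).+1.
Proof. by rewrite -[X in (_ + X)%N]mul1n addnC divnMDl// add1n. Qed.

(** The s-th translate of the discretised line of slope n / r, from which a Christoffel
    word is read off.  All these tuples fit into the ribbon. *)
Fact christoffel_lt (s : 'I_n) (l : 'I_r) : ((l * n + s) %/ r < n)%N.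
Proof. by rewrite ltn_divLR//; have := ltn_ord s; have := ltn_ord l; nia. Qed.

Fact christoffel_incr (s : 'I_n) : [forall i : 'I_r, forall j : 'I_r, (i < j)%N ==>
  ([ffun l : 'I_r => Ordinal (christoffel_lt s l)] i
     < [ffun l : 'I_r => Ordinal (christoffel_lt s l)] j)%N].
Proof.
apply/forallP => i; apply/forallP => j; apply/implyP => ij; rewrite !ffunE /=.
by rewrite -divDr leq_div2r//; nia.
Qed.

Definition christoffel (s : 'I_n) : minrep r n :=
  Sub [ffun l : 'I_r => Ordinal (christoffel_lt s l)] (christoffel_incr s).

Lemma christoffelE s l : val (christoffel s) l = ((l * n + s) %/ r)%N :> nat.
Proof. by rewrite SubK ffunE. Qed.

Hypothesis hcop : coprime r n.

(** For 0 < i < r, coprimality excludes that r divides i * n, so that the ceiling of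
    i * n / r in the definition of v is one more than the floor. *)
Lemma v_rnE (i : 'I_r) : val (v_rn hrn) i = ((i * n) %/ r)%N :> nat.
Proof.
rewrite SubK ffunE /= /vval; case: i => -[|i] ir /=; first by rewrite mul0n div0n.
rewrite minidxS /=.
have ndvd : ~~ (r %| i.+1 * n)%N.
  by rewrite Gauss_dvdl//; apply/negP => /(dvdn_leq (ltn0Sn i)); rewrite leqNgt ir.
have n0 : (0 < n)%N by apply: leq_trans rn.
have := divn_eq (i.+1 * n) r; set q := (_ %/ r)%N; set m := (_ %% r)%N => e.
have m0 : (0 < m)%N by rewrite lt0n; apply: contra ndvd => /eqP m0; apply/eqP.
have mr : (m < r)%N by rewrite ltn_mod.
rewrite e -(prednK m0) addnS /= divnMDl// divn_small ?addn0//.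
exact: leq_ltn_trans (leq_pred _) mr.
Qed.

Lemma w_rn_slope (i : 'I_r) : (val (w_rn hrn) i * r < i.+1 * n)%N.
Proof.
have n0 : (0 < n)%N by apply: leq_trans rn.
by rewrite w_rnE (leq_ltn_trans (leq_trunc_div _ _))// prednK// muln_gt0.
Qed.

Lemma v_rn_slope (i : 'I_r) : (i * n < (val (v_rn hrn) i).+1 * r)%N.
Proof. by rewrite v_rnE ltn_ceil. Qed.

Lemma v_rn_lt_w (i : 'I_r) : (val (v_rn hrn) i < val (w_rn hrn) i)%N.
Proof.
rewrite w_rnE v_rnE -divDr.
by apply: leq_div2r; rewrite mulSn; lia.
Qed.

Lemma v_rnS (i j : 'I_r) : j = i.+1 :> nat -> val (v_rn hrn) j = val (w_rn hrn) i.
Proof.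
by move=> jE; apply: ord_inj; rewrite !SubK !ffunE /= /vval jE.
Qed.

Lemma christoffel_band s l :
  (val (v_rn hrn) l <= val (christoffel s) l <= val (w_rn hrn) l)%N.
Proof.
rewrite v_rnE w_rnE christoffelE !leq_div2r ?leq_addr//.
by have := ltn_ord s; rewrite mulSn; lia.
Qed.

End Slopes.

Lemma prod_divmod (R : comPzRingType) (a b : nat) (F : nat -> R) :
  \prod_(i < a) \prod_(j < b) F (i * b + j)%N = \prod_(q < a * b) F q.
Proof.
elim: a => [|a IH]; first by rewrite !big_ord0.
by rewrite big_ord_recr IH /= mulSnr big_split_ord.
Qed.

(** The numbers l * n + s run through [0, r * n[ once, and each k < n is the
    quotient by r of exactly r of them. *)
Lemma christoffel_balanced (R : comPzRingType) r n (hrn : (0 < r < n)%N) (t : 'I_n -> R) :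
  \prod_(s < n) \prod_(l < r) t (val (christoffel hrn s) l) = (\prod_k t k) ^+ r.
Proof.
have r0 : (0 < r)%N by case/andP: hrn.
pose T j := if insub j is Some k then t k else 1.
have TE (k : 'I_n) : T k = t k by rewrite /T valK.
rewrite exchange_big /=.
transitivity (\prod_(l < r) \prod_(s < n) T ((l * n + s) %/ r)%N).
  by apply: eq_bigr => l _; apply: eq_bigr => s _; rewrite -TE christoffelE.
rewrite (prod_divmod r n (fun q => T (q %/ r)%N)) mulnC.
rewrite -(prod_divmod n r (fun q => T (q %/ r)%N)).
rewrite -prodrXl; apply: eq_bigr => k _.
rewrite (eq_bigr (fun=> t k)) ?prodr_const ?card_ord// => j _.
by rewrite divnMDl// divn_small ?addn0.
Qed.

(** * Invariant sections *)

Lemma dhomog_prod_ord (R : nzRingType) N k (p : 'I_k -> {mpoly R[N]}) :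
  (forall i, p i \is 1.-homog) -> \prod_(i < k) p i \is k.-homog.
Proof.
elim: k p => [|k IH] p hp; first by rewrite big_ord0 dhomog1.
rewrite big_ord_recr /=.
have := dhomogM (IH _ (fun i => hp (widen_ord (leqnSn k) i))) (hp ord_max).
by rewrite addn1.
Qed.

Section SectionRing.
Variables (K : closedFieldType) (r n : nat) (X : set (extpow K r n)) (q : nat).
Implicit Types (s u : X -> K).
Local Notation S := (invariant_sections X q).

Lemma invariant_sections_cst c : S 0 (cst c).
Proof.
split=> // x; exists 0%N, c%:MP, 1; have e1 y : @evalp K r n 1 y = 1 by exact: meval1.
rewrite muln0; split; rewrite ?e1 ?oner_eq0//; last 2 first.
- exact: dhomog1.
- by move=> y _; rewrite e1 divr1 /evalp mevalC.
by rewrite -[c%:MP]mulr1 mul_mpolyC dhomogZ// dhomog1.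
Qed.

Lemma invariant_sections0 m : S m 0.
Proof.
split=> // x; exists 0%N, 0, 1; have e1 y : @evalp K r n 1 y = 1 by exact: meval1.
split; rewrite ?e1 ?oner_eq0 ?dhomog0//; first exact: dhomog1.
by move=> y _; rewrite /evalp meval0 mul0r.
Qed.

Lemma invariant_sectionsD m s u : S m s -> S m u -> S m (s + u).
Proof.
move=> [s_sec s_inv] [u_sec u_inv]; split; last first.
  by move=> t x y Tt xy; rewrite !fctE (s_inv t x y) ?(u_inv t x y).
move=> x; have [d [F [G [Fd Gd Gx sE]]]] := s_sec x.
have [d' [F' [G' [Fd' Gd' Gx' uE]]]] := u_sec x.
exists (d + d')%N, (F * G' + F' * G), (G * G'); split.
- apply: rpredD.
    by rewrite -addnA [(d' + _)%N]addnC addnA; apply: dhomogM.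
  by rewrite -addnA addnC; apply: dhomogM.
- exact: dhomogM.
- by rewrite evalpM mulf_neq0.
move=> y; rewrite evalpM mulf_eq0 negb_or => /andP[Gy Gy'].
by rewrite fctE sE// uE// addf_div// evalpD !evalpM.
Qed.

Lemma invariant_sectionsM m l s u : S m s -> S l u -> S (m + l)%N (s * u).
Proof.
move=> [s_sec s_inv] [u_sec u_inv]; split; last first.
  by move=> t x y Tt xy; rewrite !fctE (s_inv t x y) ?(u_inv t x y).
move=> x; have [d [F [G [Fd Gd Gx sE]]]] := s_sec x.
have [d' [F' [G' [Fd' Gd' Gx' uE]]]] := u_sec x.
exists (d + d')%N, (F * F'), (G * G'); split.
- by rewrite mulnDr addnACA; apply: dhomogM.
- exact: dhomogM.
- by rewrite evalpM mulf_neq0.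
move=> y; rewrite evalpM mulf_eq0 negb_or => /andP[Gy Gy'].
by rewrite fctE sE// uE// mulf_div !evalpM.
Qed.

End SectionRing.

(** * The base point *)

Section BasePoint.
Variables (K : closedFieldType) (r n : nat) (A : 'M[K]_(r, n)) (u : minrep r n).
Hypothesis Au : forall i, A i (val u i) = 1.
Hypothesis GA : grassmannian (wedge A).

(** The identity matrix with the rows of A put into the columns u.  It maps e_u to the
    wedge of the rows of A, and it is triangular if the rows of A start or end at u. *)
Definition lift_mx : 'M[K]_n := \matrix_(k, k')
  if [pick i | val u i == k'] is Some i then A i k else (k == k')%:R.

Let lift_col i k : lift_mx k (val u i) = A i k.
Proof.
rewrite mxE; case: pickP => [j /eqP/minrep_inj->//|/(_ i)].
by rewrite eqxx.
Qed.

Let lift_diag k : lift_mx k k = 1.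
Proof. by rewrite mxE; case: pickP => [j /eqP <-|_]; rewrite ?Au ?eqxx. Qed.

Lemma extact_lift : extact lift_mx (ebasis K u) = wedge A.
Proof.
apply/ffunP => I; rewrite extact_ebasis ffunE -det_tr; congr (\det _).
by apply/matrixP => i j; rewrite [LHS]mxE [LHS]mxE lift_col mxE.
Qed.

Lemma wedge_schubert : (forall i (k : 'I_n), (val u i < k)%N -> A i k = 0) ->
  schubert u (wedge A).
Proof.
move=> A0; split=> // d F _; apply; exists lift_mx; last exact: extact_lift.
have utri : is_trig_mx lift_mx^T.
  apply/is_trig_mxP => k' k kk'; rewrite [LHS]mxE [LHS]mxE.
  case: pickP => [i /eqP ui|_]; first by apply: A0; rewrite ui.
  by rewrite -val_eqE /= gtn_eqF.
split=> //; rewrite /SL /= -det_tr det_trig// big1// => k _.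
by rewrite mxE lift_diag.
Qed.

Lemma wedge_schubert_opp : (forall i (k : 'I_n), (k < val u i)%N -> A i k = 0) ->
  schubert_opp u (wedge A).
Proof.
move=> A0; split=> // d F _; apply; exists lift_mx; last exact: extact_lift.
have ltri : is_trig_mx lift_mx.
  apply/is_trig_mxP => k k' kk'; rewrite [LHS]mxE.
  case: pickP => [i /eqP ui|_]; first by apply: A0; rewrite ui.
  by rewrite -val_eqE /= ltn_eqF.
by split=> //; rewrite /SL /= det_trig// big1.
Qed.

End BasePoint.

Section Ribbon.
Variables (K : closedFieldType) (r n : nat) (hrn : (0 < r < n)%N) (hcop : coprime r n).
Let v := v_rn hrn.
Let w := w_rn hrn.
Let X := richardson K v w.
Let rn : (r < n)%N. Proof. by case/andP: hrn. Qed.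
Let n0 : (0 < n)%N. Proof. exact: leq_ltn_trans rn. Qed.
Let A0 := band_mx K (val v) (val w).
Let v_lt_w i : (val v i < val w i)%N := v_rn_lt_w hrn hcop i.

Lemma det_ribbon (I : minrep r n) : (forall i, val v i <= val I i <= val w i)%N ->
  wedge A0 I = 1.
Proof.
move=> Ib; rewrite ffunE; apply: det_band_mx => //; try exact: minrep_lt.
exact: v_rnS.
Qed.

Lemma richardson_ribbon : X (wedge A0).
Proof.
have Aw : forall i, A0 i (val w i) = 1 by move=> i; rewrite mxE leqnn ltnW.
have Av : forall i, A0 i (val v i) = 1 by move=> i; rewrite mxE leqnn ltnW.
have G0 : grassmannian (wedge A0).
  split; last by exists A0.
  apply/eqP => /ffunP/(_ w); rewrite det_ribbon => [|i]; last by rewrite leqnn ltnW.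
  by rewrite ffunE => /eqP; rewrite oner_eq0.
split; first apply: wedge_schubert => // i k wk.
  by rewrite mxE leqNgt [(k <= _)%N]leqNgt wk andbF.
by apply: wedge_schubert_opp => // i k kv; rewrite mxE [(_ <= k)%N]leqNgt kv.
Qed.

Let x0 : X := exist (fun u => u \in X) _ (mem_set richardson_ribbon).

(** At a point where s does not vanish, no J is destabilising; so the point is a
    torus translate of x0, where s is determined by s x0. *)
Lemma section_ribbon0 m (s : X -> K) : (0 < m)%N -> invariant_sections X n m s ->
  s x0 = 0 -> s = 0.
Proof.
move=> m0 Ss s0; apply/funext => x; apply: contrapT => sx.
have nm : (0 < n * m)%N by rewrite muln_gt0 n0.
have XA : X (val x) by apply: set_mem; apply: valP.
have [_ [A xA]] := proj1 (proj1 XA).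
rewrite xA in XA.
have ss (J : {set 'I_n}) :
    exists2 f, basis A f & (#|[set j | f j \in J]| * n <= #|J| * r)%N.
  apply: contrapT => nss; apply: sx; apply: (unstable_section0 (J := J) Ss nm xA) => f Af.
  by rewrite ltnNge; apply/negP => le; apply: nss; exists f.
have [C C0 CA] := band_form (@minrep_lt _ _ v) (@minrep_lt _ _ w) (@v_rnS _ _ hrn)
  (v_rn_slope hrn hcop) (w_rn_slope hrn) rn (fun f => @richardson_le _ _ _ _ _ _ f XA)
  (fun f => @richardson_ge _ _ _ _ _ _ f XA) ss.
have [a [t [a0 t0 CAE]]] := band_torus (@minrep_lt _ _ v) (@v_rnS _ _ hrn) v_lt_w CA.
(* Dividing t by an n-th root of its determinant puts it into SL; the row factors
   absorb the root. *)
have [c cn] := exists_root (\prod_k t 0 k) n0.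
have c0 : c != 0.
  apply: contraTneq (_ : \prod_k t 0 k != 0) => [c0|]; last by apply/prodf_neq0.
  by rewrite -cn c0 expr0n gtn_eqF// eqxx.
pose t' : 'rV[K]_n := \row_k (t 0 k / c).
have t'1 : \prod_k t' 0 k = 1.
  under eq_bigr do rewrite mxE.
  by rewrite big_split /= prodr_const card_ord -cn -exprMn divff// expr1n.
pose C' := invmx C *m diag_mx (\row_i (a 0 i * c)).
have AE : A = C' *m A0 *m diag_mx t'.
  have Cu : C \in unitmx by rewrite unitmxE unitfE.
  rewrite /C' -!mulmxA -[LHS](mulKmx Cu); congr (_ *m _).
  apply/matrixP => i k; rewrite CAE mulmxA mul_mx_diag mxE mul_diag_mx !mxE.
  by field.
have C'0 : \det C' != 0.
  rewrite det_mulmx det_inv mulf_neq0 ?invr_eq0// det_diag.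
  by apply/prodf_neq0 => i _; rewrite mxE mulf_neq0.
apply: sx; rewrite (section_move (x := x0) Ss C'0 t'1 (erefl _)); last by rewrite xA AE.
by rewrite s0 mulr0.
Qed.

Definition christoffel_section (x : X) : K := \prod_(s < n) val x (christoffel hrn s).

Lemma christoffel_section_inv : invariant_sections X n 1 christoffel_section.
Proof.
split.
  move=> x; exists 0%N, (\prod_(s < n) pluecker K (christoffel hrn s)), 1.
  have e1 (y : extpow K r n) : evalp 1 y = 1 by exact: meval1.
  split.
  - by rewrite add0n muln1; apply: dhomog_prod_ord => s; apply: pluecker_homog.
  - exact: dhomog1.
  - by rewrite e1 oner_eq0.
  - move=> y _; rewrite e1 divr1 /evalp rmorph_prod; apply: eq_bigr => s _.
    by rewrite -evalp_pluecker.
move=> g x y /torusP[t t1 ->]; rewrite extact_diag => yE.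
rewrite /christoffel_section yE; under eq_bigr do rewrite ffunE.
by rewrite big_split /= /weight christoffel_balanced t1 expr1n mul1r.
Qed.

Lemma christoffel_section_ribbon : christoffel_section x0 = 1.
Proof. by apply: big1 => s _; apply: det_ribbon => i; apply: christoffel_band. Qed.

(** The multiples of x0 belong to the cone over X. *)
Lemma ray_ribbon c : c != 0 -> exists y : X, forall m s,
  invariant_sections X n m s -> s y = c ^+ (n * m) * s x0.
Proof.
move=> c0; have /andP[r0 _] := hrn.
pose C : 'M[K]_r := diag_mx (\row_i (if i == Ordinal r0 then c else 1)).
have dC : \det C = c.
  rewrite det_diag (bigD1 (Ordinal r0))//= mxE eqxx big1 ?mulr1// => i i0.
  by rewrite mxE (negPf i0).
pose t : 'rV[K]_n := const_mx 1.
have t1 : \prod_k t 0 k = 1 by apply: big1 => k _; rewrite mxE.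
have C0 : \det C != 0 by rewrite dC.
pose y : X :=
  exist (fun u => u \in X) _ (mem_set (richardson_move C0 t1 richardson_ribbon)).
exists y => m s Ss.
by rewrite (section_move (x := x0) (y := y) Ss C0 t1 (erefl _) (erefl _)) dC.
Qed.

End Ribbon.

Theorem theorem3p4 (R : realType) (r n : nat) (hrn : (0 < r < n)%N)
    (hcop : coprime r n) :
  Proj_is_point
    (invariant_sections (richardson R[i] (v_rn hrn) (w_rn hrn)) n).
Proof.
have n0 : (0 < n)%N by case/andP: hrn => _; apply: leq_ltn_trans.
apply: (@Proj_is_point_ev _ _ _ n _ n0 _ _ _ _ (ray_ribbon hrn hcop)
  (fun m f => @section_ribbon0 _ _ _ hrn hcop m f) 1 _ isT
  (christoffel_section_inv _ hrn)).
- exact: invariant_sections0.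
- exact: invariant_sectionsD.
- exact: invariant_sectionsM.
- exact: invariant_sections_cst.
- by rewrite christoffel_section_ribbon oner_eq0.
Qed.
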